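(* Let $\{x^k\}_{k\in\mathbb{N}}$ be an (infinite) sequence generated by Algorithm RiVMPL (described in the context) and assume that it is bounded. If the potential function $\Xi_{\widetilde{c}}$ defined in the context has the Kurdyka-Lojasiewicz (KL) property at every point of the set $U^*$ (the set of cluster points of $\{u^k\}_{k\in\mathbb{N}}$, defined in the context), then $\sum_{k=1}^\infty\|x^{k+1}-x^k\|<\infty$, and consequently $\{x^k\}_{k\in\mathbb{N}}$ converges to some $x^*\in\Omega(x^0)$, where $\Omega(x^0)$ is the set of cluster points of $\{x^k\}_{k\in\mathbb{N}}$.
   Context: Setting. $\mathbb{X},\mathbb{Z}$ are finite-dimensional real inner product spaces with induced norms $\|\cdot\|$; $\mathcal{M}\subset\mathbb{X}$ is a $\mathcal{C}^2$-smooth embedded closed submanifold with tangent spaces $T_x\mathcal{M}$ and tangent bundle $T\mathcal{M}=\{(x,d)\mid x\in\mathcal{M},d\in T_x\mathcal{M}\}$. The problem is $\min_{x\in\mathcal{M}}\Theta(x):=f(x)+\vartheta(F(x))$ under the standing assumptions: (i) $f:\mathbb{X}\to(-\infty,\infty]$ is proper, lower semicontinuous, and $\mathcal{C}^{1,1}$ (differentiable with locally Lipschitz gradient) on an open convex set $\mathcal{O}\supset\mathcal{M}$; (ii) $\vartheta:\mathbb{Z}\to\mathbb{R}$ is convex with a closed-form proximal mapping; (iii) $F:\mathbb{X}\to\mathbb{Z}$ is $\mathcal{C}^{1,1}$ on $\mathcal{O}$ (differentiable with locally Lipschitz derivative); (iv) $\inf_{x\in\mathcal{M}}\Theta(x)>-\infty$.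 $F'(x)$ is the differential, $\nabla F(x)$ its adjoint, and $\ell_F(x;z):=F(z)+F'(z)(x-z)$. $\mathcal{I}$ is the identity, $\|v\|_{\mathcal{Q}}^2:=\langle v,\mathcal{Q}v\rangle$, $\delta_C$ is the indicator function of $C$, and ${\rm lip}\,g(x)$ is the Lipschitz modulus of $g$ at $x$. A retraction is a smooth map $R:T\mathcal{M}\to\mathcal{M}$ such that $R_x:=R(x,\cdot):T_x\mathcal{M}\to\mathcal{M}$ satisfies $R_x(0)=x$ and $R_x'(0)=\mathcal{I}$ for every $x\in\mathcal{M}$. Algorithm RiVMPL. Input: a retraction $R$, parameters $0<\alpha_{\min}\le\alpha_{\max}$, $\mu_{\max}>0$, $\overline{\alpha}>0$, $\overline{\gamma}>0$, $\sigma>1$, and $x^0\in\mathcal{M}$. For $k=0,1,2,\ldots$: choose $\alpha_{k,0}\in[\alpha_{\min},\alpha_{\max}]$ and $\mu_k\in(0,\mu_{\max}]$. Inner loop, $j=0,1,2,\ldots$: choose a self-adjoint linear operator $\mathcal{Q}_{k,j}:\mathbb{X}\to\mathbb{X}$ with $\alpha_{k,j}\mathcal{I}\preceq\mathcal{Q}_{k,j}\preceq(\overline{\alpha}+\alpha_{k,j})\mathcal{I}$; let $$\Theta_{k,j}(v):=\langle\nabla f(x^k),v\rangle+\tfrac12\|v\|^2_{\mathcal{Q}_{k,j}}+\vartheta(\ell_F(x^k+v;x^k))+f(x^k)$$ and let $\overline{v}^{k,j}$ be its unique minimizer over $v\in T_{x^k}\mathcal{M}$; find $(v^{k,j},\Theta^{\rm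 LB}_{k,j})\in T_{x^k}\mathcal{M}\times(-\infty,\Theta_{k,j}(\overline{v}^{k,j})]$ with $\Theta_{k,j}(v^{k,j})\le\Theta_{k,j}(0)$ and $\Theta_{k,j}(v^{k,j})-\Theta^{\rm LB}_{k,j}\le\frac{\mu_k}{2}\|v^{k,j}\|^2$. If $\Theta(R_{x^k}(v^{k,j}))\le\Theta_{k,j}(v^{k,j})-\frac{\overline{\gamma}}{2}\|v^{k,j}\|^2$ or $\|v^{k,j}\|=0$, leave the inner loop; else set $\alpha_{k,j+1}:=\sigma\alpha_{k,j}$ and continue it. After the inner loop: if $\|v^{k,j}\|=0$, stop; else set $j_k:=j$, $v^k:=v^{k,j_k}$, $\overline{v}^k:=\overline{v}^{k,j_k}$, $\mathcal{Q}_k:=\mathcal{Q}_{k,j_k}$, $\Theta_k:=\Theta_{k,j_k}$, $x^{k+1}:=R_{x^k}(v^k)$. Constants (for bounded $\{x^k\}$, with a compact $\Lambda_0\subset\mathcal{M}$ containing $\{x^k\}$). There is $b_\alpha>0$ with $\alpha_{k,j}\le b_\alpha$ for all $k$ and $j\in\{0,\ldots,j_k\}$; fix one and put $\alpha^*:=b_\alpha+\overline{\alpha}$. Let $\Gamma\subset\mathcal{O}$ be a compact convex set containing $\{x^k\}$ and $D\subset\mathbb{Z}$ a compact set containing $\{\ell_F(x^k+v^k;x^k)\}_{k}\cup\{\ell_F(x^{k+1};x^k)\}_{k}$; $L_{\nabla f}$ and $L_\vartheta$ are Lipschitz constants of $\nabla f$ on $\Gamma$ and of $\vartheta$ on $D$;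 $b_\vartheta:=\sup_k{\rm lip}\,\vartheta(F(x^k))$ (Lipschitz modulus of $\vartheta$ at $F(x^k)$), $b_{\nabla F}:=\sup_k{\rm lip}\,F'(x^k)$ (Lipschitz modulus of $F'$ at $x^k$), $c_{\nabla f}:=\sup_k\|\nabla f(x^k)\|$, $c_{\nabla F}:=\sup_k\|F'(x^k)\|$; $M_1,M_2>0$ are constants with $\|R_x(v)-x\|\le M_1\|v\|$ and $\|R_x(v)-x-v\|\le M_2\|v\|^2$ for all $x\in\Lambda_0$, $v\in T_x\mathcal{M}$, $\|v\|\le1$. Put $\widetilde{c}:=(1+b_\vartheta b_{\nabla F}+L_{\nabla f})M_1^2+2M_2(c_{\nabla f}+c_{\nabla F}L_\vartheta)+\mu_{\max}$. Potential function. Fix orthonormal bases $\{e_i\}_{i=1}^p$ of $\mathbb{X}$ and $\{d_i\}_{i=1}^r$ of $\mathbb{Z}$; let $\mathcal{E}^\dagger:\mathbb{X}\to\mathbb{R}^p$, $\mathcal{E}^\dagger x=(\langle e_1,x\rangle,\ldots,\langle e_p,x\rangle)^\top$, and $\mathcal{F}:\mathbb{R}^r\to\mathbb{Z}$, $\mathcal{F}\widehat{z}=\sum_i\widehat{z}_id_i$. Let $Q^k\in\mathbb{R}^{r\times p}$ be the matrix of $F'(x^k)$ in these bases, so $F'(x^k)v=\mathcal{F}Q^k\mathcal{E}^\dagger v$. For $w=(x,v,Q,s)\in\mathbb{W}:=\mathbb{X}\times\mathbb{X}\times\mathbb{R}^{r\times p}\times\mathbb{X}$ and $\eta\in\mathbb{X}$,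 $$\Xi(w):=f(x)+\langle s,v\rangle+\vartheta(F(x)+\mathcal{F}Q\mathcal{E}^\dagger v)+\delta_{T\mathcal{M}}(x,v)+\tfrac{\alpha^*}{2}\|v\|^2,\qquad \Xi_{\widetilde{c}}(w,\eta):=\Xi(w)+\tfrac{\widetilde{c}}{2}\|\eta\|^2.$$ Put $w^k:=(x^k,\overline{v}^k,Q^k,\nabla f(x^k))$, $u^k:=(w^k,v^k)$, and let $U^*$ be the set of cluster points of $\{u^k\}_{k\in\mathbb{N}}$. KL property. For $\varpi>0$, $\Upsilon_\varpi$ is the set of continuous concave $\varphi:[0,\varpi)\to\mathbb{R}_+$ that are continuously differentiable on $(0,\varpi)$ with $\varphi(0)=0$ and $\varphi'>0$ on $(0,\varpi)$. A proper lsc $h$ has the KL property at $\overline{x}\in{\rm dom}\,\partial h$ ($\partial$ the limiting subdifferential) if there are $\delta>0$, $\varpi\in(0,\infty]$, $\varphi\in\Upsilon_\varpi$ with $\varphi'(h(x)-h(\overline{x}))\,{\rm dist}(0,\partial h(x))\ge1$ for all $x$ with $\|x-\overline{x}\|\le\delta$ and $h(\overline{x})<h(x)<h(\overline{x})+\varpi$. *)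

(* Defs.v *)
From HB Require Import structures.
From mathcomp Require Export all_boot all_order all_algebra.
From mathcomp Require Export all_classical all_reals all_analysis.
From mathcomp Require Export sesquilinear.
Export numFieldNormedType.Exports.
Export Order.TTheory GRing.Theory Num.Theory.

Set Implicit Arguments.
Unset Strict Implicit.
Unset Printing Implicit Defensive.

Local Open Scope classical_set_scope.
Local Open Scope ring_scope.

(* A finite-dimensional real inner product space is a normed module [X]
   together with a dot product [ip : {dot X for idfun}] inducing the norm and an
   orthonormal basis [e : 'I_p -> X]. *)

Definition induced_norm (R : realType) (X : normedModType R)
    (ip : X -> X -> R) : Prop :=
  forall x : X, `|x| = Num.sqrt (ip x x).

Definition orthonormal_basis (R : realType) (X : lmodType R)
    (ip : X -> X -> R) (p : nat) (e : 'I_p -> X) : Prop :=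
  (forall i j, ip (e i) (e j) = (i == j)%:R) /\
  (forall x : X, x = \sum_(i < p) ip (e i) x *: e i).

Definition dotnorm (R : realType) (E : lmodType R) (ip : E -> E -> R) (x : E)
    : R :=
  Num.sqrt (ip x x).

Definition prod_dot (R : realType) (E1 E2 : lmodType R)
    (ip1 : E1 -> E1 -> R) (ip2 : E2 -> E2 -> R) (u w : E1 * E2) : R :=
  ip1 u.1 w.1 + ip2 u.2 w.2.

Definition mx_dot (R : realType) (m n : nat) (A B : 'M[R]_(m, n)) : R :=
  \tr (A^T *m B).

(* For maps between finite-dimensional spaces, [f] is [C^k] on [U] iff all its
   iterated directional derivatives of order at most [k] exist (in the Fréchet
   sense) and are continuous. *)

Fixpoint Ck (R : realType) (X Y : normedModType R) (k : nat) (U : set X)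
    (f : X -> Y) {struct k} : Prop :=
  match k with
  | 0%N => forall x, U x -> {for x, continuous f}
  | k'.+1 => (forall x, U x -> differentiable f x) /\
             (forall v : X, Ck k' U (fun x => 'd f x v))
  end.

Definition opnorm (R : realType) (X Y : normedModType R) (T : X -> Y) : R :=
  sup [set `|T v| | v in [set v : X | `|v| <= 1]].

(* [N] is the norm on the codomain: [Num.norm] for a vector-valued map, [opnorm]
   for a derivative [fun x => 'd F x]. *)
Definition locally_lipschitz (R : realType) (X : normedModType R)
    (V : zmodType) (N : V -> R) (A : set X) (g : X -> V) : Prop :=
  forall x, A x -> exists L : R, \forall yz \near (x, x),
    N (g yz.1 - g yz.2) <= L * `|yz.1 - yz.2|.

(* The Lipschitz modulus
     limsup_{y, z -> x, y <> z} N (g y - g z) / |y - z|.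
   Pairs with y = z contribute the value _ / 0 = 0, which does not affect the
   limsup of a nonnegative quotient (and makes it 0 on the trivial space). *)
Definition lip (R : realType) (X : normedModType R) (V : zmodType)
    (N : V -> R) (g : X -> V) (x : X) : \bar R :=
  limf_esup (fun yz : X * X =>
    (N (g yz.1 - g yz.2) / `|yz.1 - yz.2|)%:E) (nbhs (x, x)).

Definition gradient (R : realType) (X : normedModType R) (ip : X -> X -> R)
    (f : X -> R) (x : X) : X :=
  xget 0 [set g : X | forall v, ip g v = 'd f x v].

(* l_F(x; z): linearized at the second point, evaluated at the first. *)
Definition linearization (R : realType) (X Z : normedModType R) (F : X -> Z)
    (x z : X) : Z :=
  F z + 'd F z (x - z).

Definition indicator_fun (R : realType) (T : Type) (C : set T) (x : T)
    : \bar R :=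
  if `[< C x >] then 0%E else +oo%E.

(* Slice charts: near each of its points, [M] is carried by a C^2
   diffeomorphism [psi] (with inverse [chi]) between open subsets of [X] onto a
   piece of the span of the first [n] basis vectors. *)
Definition C2_submanifold (R : realType) (X : normedModType R)
    (ip : X -> X -> R) (p : nat) (e : 'I_p -> X) (M : set X) : Prop :=
  exists n : nat, forall x, M x ->
    exists (U V : set X) (psi chi : X -> X),
      [/\ open U, U x & open V] /\
      [/\ Ck 2 U psi, Ck 2 V chi, psi @` U = V &
          forall y, U y -> chi (psi y) = y] /\
      (forall y, U y ->
         (M y <-> forall i : 'I_p, (n <= i)%N -> ip (e i) (psi y) = 0)).

Definition tangent (R : realType) (X : normedModType R) (M : set X) (x : X)
    : set X :=
  [set v | exists (eps : R) (c : R -> X),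
     [/\ 0 < eps, Ck 1 [set t : R | `|t| < eps] c,
         forall t, `|t| < eps -> M (c t), c 0 = x & derive1 c 0 = v]].

Definition tangent_bundle (R : realType) (X : normedModType R) (M : set X)
    : set (X * X) :=
  [set xv | M xv.1 /\ tangent M xv.1 xv.2].

(* For a C^2 submanifold the tangent bundle is a manifold of class C^1 only, so
   smoothness of [Rt] on it means C^1, i.e. having local C^1 extensions to the
   ambient space. Values of [Rt] outside the tangent bundle are irrelevant. *)
Definition retraction (R : realType) (X : normedModType R) (M : set X)
    (Rt : X -> X -> X) : Prop :=
  [/\ forall x v, tangent_bundle M (x, v) -> M (Rt x v),
      forall xv, tangent_bundle M xv ->
        exists (W : set (X * X)) (G : X * X -> X),
          [/\ open W, W xv, Ck 1 W G &
              forall yw, W yw -> tangent_bundle M yw -> G yw = Rt yw.1 yw.2],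
      forall x, M x -> Rt x 0 = x &
      forall x, M x -> forall eps : R, 0 < eps ->
        \forall v \near (0 : X), tangent M x v ->
          `|Rt x v - Rt x 0 - v| <= eps * `|v|].

Definition objective (R : realType) (X Z : normedModType R)
    (f : X -> \bar R) (theta : Z -> R) (F : X -> Z) (x : X) : \bar R :=
  (f x + (theta (F x))%:E)%E.

Record standing_assumptions (R : realType) (X Z : normedModType R)
    (ip : X -> X -> R) (M O : set X) (f : X -> \bar R) (theta : Z -> R)
    (F : X -> Z) : Prop := {
  sa_open : open O;
  sa_convex : convex_set O;
  sa_sub : M `<=` O;
  sa_f_proper : (forall x, -oo < f x)%E /\ (exists x, f x < +oo)%E;
  sa_f_lsc : lower_semicontinuous f;
  sa_f_fin : forall x, O x -> f x \is a fin_num;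
  sa_f_diff : forall x, O x -> differentiable (fine \o f) x;
  sa_f_lip : locally_lipschitz Num.norm O (gradient ip (fine \o f));
  sa_theta : convex_function [set: Z] theta;
  sa_F_diff : forall x, O x -> differentiable F x;
  sa_F_lip :
    locally_lipschitz (@opnorm R X Z) O (fun x => 'd F x : X -> Z);
  sa_lower_bound : (-oo < ereal_inf (objective f theta F @` M))%E
}.

Definition model (R : realType) (X Z : normedModType R)
    (ip : X -> X -> R) (f : X -> \bar R) (theta : Z -> R) (F : X -> Z)
    (x : X) (Q : X -> X) (v : X) : R :=
  ip (gradient ip (fine \o f) x) v + 2^-1 * ip v (Q v)
  + theta (linearization F (x + v) x) + fine (f x).

Record RiVMPL_parameters (R : realType) := {
  alpha_min : R;
  alpha_max : R;
  mu_max : R;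
  alpha_bar : R;
  gamma_bar : R;
  sigma : R;
  alpha_min_gt0 : 0 < alpha_min;
  alpha_min_le_max : alpha_min <= alpha_max;
  mu_max_gt0 : 0 < mu_max;
  alpha_bar_gt0 : 0 < alpha_bar;
  gamma_bar_gt0 : 0 < gamma_bar;
  sigma_gt1 : 1 < sigma
}.

Definition inner_exit (R : realType) (X Z : normedModType R)
    (ip : X -> X -> R) (f : X -> \bar R) (theta : Z -> R) (F : X -> Z)
    (Rt : X -> X -> X) (gamma : R) (x : X) (Q : X -> X) (v : X) : Prop :=
  (objective f theta F (Rt x v) <=
    (model ip f theta F x Q v - gamma / 2 * `|v| ^+ 2)%:E)%E \/ `|v| = 0.

(* An infinite run of the algorithm: at every outer iteration [k] the inner loop
   is left at index [jk k] with a nonzero step. The inner data at [(k, j)] are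
   meaningful, and constrained, only for [j <= jk k]. *)
Record RiVMPL_run (R : realType) (X Z : normedModType R)
    (ip : X -> X -> R) (M : set X) (f : X -> \bar R) (theta : Z -> R)
    (F : X -> Z) (Rt : X -> X -> X) (P : RiVMPL_parameters R)
    (x : nat -> X) (alpha : nat -> nat -> R) (mu : nat -> R)
    (Q : nat -> nat -> {linear X -> X}) (vbar v : nat -> nat -> X)
    (LB : nat -> nat -> R) (jk : nat -> nat) : Prop := {
  run_init : M (x 0%N);
  run_alpha0 : forall k, alpha_min P <= alpha k 0%N <= alpha_max P;
  run_mu : forall k, 0 < mu k <= mu_max P;
  run_Q_selfadjoint : forall k j, (j <= jk k)%N ->
    forall u w, ip (Q k j u) w = ip u (Q k j w);
  run_Q_bounds : forall k j, (j <= jk k)%N ->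
    forall u, alpha k j * `|u| ^+ 2 <= ip u (Q k j u)
              <= (alpha_bar P + alpha k j) * `|u| ^+ 2;
  run_vbar_tangent : forall k j, (j <= jk k)%N -> tangent M (x k) (vbar k j);
  run_vbar_min : forall k j, (j <= jk k)%N ->
    forall u, tangent M (x k) u ->
      model ip f theta F (x k) (Q k j) (vbar k j)
      <= model ip f theta F (x k) (Q k j) u;
  run_v_tangent : forall k j, (j <= jk k)%N -> tangent M (x k) (v k j);
  run_LB : forall k j, (j <= jk k)%N ->
    LB k j <= model ip f theta F (x k) (Q k j) (vbar k j);
  run_v_descent : forall k j, (j <= jk k)%N ->
    model ip f theta F (x k) (Q k j) (v k j)
    <= model ip f theta F (x k) (Q k j) 0;
  run_v_inexact : forall k j, (j <= jk k)%N ->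
    model ip f theta F (x k) (Q k j) (v k j) - LB k j
    <= mu k / 2 * `|v k j| ^+ 2;
  run_continue : forall k j, (j < jk k)%N ->
    ~ inner_exit ip f theta F Rt (gamma_bar P) (x k) (Q k j) (v k j) /\
    alpha k j.+1 = sigma P * alpha k j;
  run_exit : forall k,
    inner_exit ip f theta F Rt (gamma_bar P) (x k) (Q k (jk k)) (v k (jk k));
  run_no_stop : forall k, `|v k (jk k)| <> 0;
  run_next : forall k, x k.+1 = Rt (x k) (v k (jk k))
}.

Record RiVMPL_constants (R : realType) := {
  b_alpha : R;
  L_grad_f : R;
  L_theta : R;
  M1 : R;
  M2 : R
}.

(* [v k] is the accepted step, i.e. [v k (jk k)] in a run. *)
Record valid_constants (R : realType) (X Z : normedModType R)
    (ip : X -> X -> R) (M O : set X) (f : X -> \bar R) (theta : Z -> R)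
    (F : X -> Z) (Rt : X -> X -> X)
    (x : nat -> X) (alpha : nat -> nat -> R) (v : nat -> X) (jk : nat -> nat)
    (Lam0 Gamma : set X) (D : set Z) (K : RiVMPL_constants R) : Prop := {
  vc_Lam0 : [/\ compact Lam0, Lam0 `<=` M & range x `<=` Lam0];
  vc_b_alpha : 0 < b_alpha K;
  vc_alpha_le : forall k j, (j <= jk k)%N -> alpha k j <= b_alpha K;
  vc_Gamma : [/\ compact Gamma, convex_set Gamma, Gamma `<=` O &
                 range x `<=` Gamma];
  vc_D_compact : compact D;
  vc_D_step : forall k, D (linearization F (x k + v k) (x k));
  vc_D_next : forall k, D (linearization F (x k.+1) (x k));
  vc_L_grad_f_ge0 : 0 <= L_grad_f K;
  vc_L_grad_f :
    (L_grad_f K).-lipschitz_Gamma (gradient ip (fine \o f) : X -> X);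
  vc_L_theta_ge0 : 0 <= L_theta K;
  vc_L_theta : (L_theta K).-lipschitz_D theta;
  vc_M1_gt0 : 0 < M1 K;
  vc_M2_gt0 : 0 < M2 K;
  vc_M1 : forall y u, Lam0 y -> tangent M y u -> `|u| <= 1 ->
    `|Rt y u - y| <= M1 K * `|u|;
  vc_M2 : forall y u, Lam0 y -> tangent M y u -> `|u| <= 1 ->
    `|Rt y u - y - u| <= M2 K * `|u| ^+ 2
}.

Definition b_theta (R : realType) (X Z : normedModType R) (theta : Z -> R)
    (F : X -> Z) (x : nat -> X) : R :=
  fine (ereal_sup (range (fun k => lip Num.norm theta (F (x k))))).

Definition b_dF (R : realType) (X Z : normedModType R) (F : X -> Z)
    (x : nat -> X) : R :=
  fine (ereal_sup (range (fun k =>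
    lip (@opnorm R X Z) (fun y => 'd F y : X -> Z) (x k)))).

Definition c_grad_f (R : realType) (X : normedModType R) (ip : X -> X -> R)
    (f : X -> \bar R) (x : nat -> X) : R :=
  sup (range (fun k => `|gradient ip (fine \o f) (x k)|)).

Definition c_dF (R : realType) (X Z : normedModType R) (F : X -> Z)
    (x : nat -> X) : R :=
  sup (range (fun k => opnorm ('d F (x k) : X -> Z))).

Definition c_tilde (R : realType) (X Z : normedModType R) (ip : X -> X -> R)
    (f : X -> \bar R) (theta : Z -> R) (F : X -> Z) (P : RiVMPL_parameters R)
    (K : RiVMPL_constants R) (x : nat -> X) : R :=
  (1 + b_theta theta F x * b_dF F x + L_grad_f K) * M1 K ^+ 2
  + 2 * M2 K * (c_grad_f ip f x + c_dF F x * L_theta K) + mu_max P.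

Definition coords (R : realType) (X : lmodType R) (ip : X -> X -> R) (p : nat)
    (e : 'I_p -> X) (x : X) : 'cV[R]_p :=
  \col_i ip (e i) x.

Definition of_coords (R : realType) (Z : lmodType R) (r : nat)
    (d : 'I_r -> Z) (z : 'cV[R]_r) : Z :=
  \sum_(i < r) z i 0 *: d i.

(* The matrix of ['d F x] in the orthonormal bases [e] and [d]. *)
Definition diff_mx (R : realType) (X Z : normedModType R)
    (ipZ : Z -> Z -> R) (p r : nat) (e : 'I_p -> X) (d : 'I_r -> Z)
    (F : X -> Z) (x : X) : 'M[R]_(r, p) :=
  \matrix_(i, j) ipZ (d i) ('d F x (e j)).

Definition Xi (R : realType) (X Z : normedModType R) (ip : X -> X -> R)
    (p r : nat) (e : 'I_p -> X) (d : 'I_r -> Z) (M : set X)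
    (f : X -> \bar R) (theta : Z -> R) (F : X -> Z) (alpha_star : R)
    (w : X * X * 'M[R]_(r, p) * X) : \bar R :=
  let: (x, v, Q, s) := w in
  (f x
   + (ip s v + theta (F x + of_coords d (Q *m coords ip e v)))%:E
   + indicator_fun R (tangent_bundle M) (x, v)
   + (alpha_star / 2 * `|v| ^+ 2)%:E)%E.

Definition Xi_c (R : realType) (X Z : normedModType R) (ip : X -> X -> R)
    (p r : nat) (e : 'I_p -> X) (d : 'I_r -> Z) (M : set X)
    (f : X -> \bar R) (theta : Z -> R) (F : X -> Z) (alpha_star c : R)
    (u : X * X * 'M[R]_(r, p) * X * X) : \bar R :=
  (Xi ip e d M f theta F alpha_star u.1 + (c / 2 * `|u.2| ^+ 2)%:E)%E.

(* The inner product of the domain of [Xi_c]. The norm that the library puts on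
   a product is the max norm: topology only is taken from it, while [dotnorm] is
   used wherever a norm is needed. *)
Definition potential_dot (R : realType) (X : normedModType R)
    (ip : X -> X -> R) (p r : nat)
    : X * X * 'M[R]_(r, p) * X * X -> X * X * 'M[R]_(r, p) * X * X -> R :=
  prod_dot
    (prod_dot (prod_dot (prod_dot ip ip) (@mx_dot R r p)) ip) ip.

Definition regular_subdiff (R : realType) (E : lmodType R) (ip : E -> E -> R)
    (h : E -> \bar R) (x : E) : set E :=
  [set v | h x \is a fin_num /\
     forall eps : R, 0 < eps -> exists2 delta : R, 0 < delta &
       forall y, dotnorm ip (y - x) < delta ->
         (h x + (ip v (y - x) - eps * dotnorm ip (y - x))%:E <= h y)%E].

Definition limiting_subdiff (R : realType) (E : lmodType R) (ip : E -> E -> R)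
    (h : E -> \bar R) (x : E) : set E :=
  [set v | h x \is a fin_num /\
     exists (y w : nat -> E),
       [/\ (fun n => dotnorm ip (y n - x)) @ \oo --> (0 : R),
           (fun n => h (y n)) @ \oo --> h x,
           forall n, regular_subdiff ip h (y n) (w n) &
           (fun n => dotnorm ip (w n - v)) @ \oo --> (0 : R)]].

(* +oo when [C] is empty. *)
Definition dist0 (R : realType) (E : lmodType R) (ip : E -> E -> R)
    (C : set E) : \bar R :=
  ereal_inf [set (dotnorm ip v)%:E | v in C].

(* The class of desingularizing functions; only the values on [0, varpi[
   matter. *)
Definition Upsilon (R : realType) (varpi : \bar R) (phi : R -> R) : Prop :=
  let D := [set t : R | 0 <= t /\ (t%:E < varpi)%E] in
  [/\ {within D, continuous phi},
      convex_function (D : set R^o) (fun t => - phi t),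
      forall t, D t -> 0 <= phi t,
      phi 0 = 0 &
      forall t, 0 < t -> (t%:E < varpi)%E ->
        [/\ derivable phi t 1, {for t, continuous (derive1 phi)} & 0 < derive1 phi t]].

Definition KL_property (R : realType) (E : lmodType R) (ip : E -> E -> R)
    (h : E -> \bar R) (xbar : E) : Prop :=
  limiting_subdiff ip h xbar !=set0 /\
  exists (delta : R) (varpi : \bar R) (phi : R -> R),
    [/\ 0 < delta, (0 < varpi)%E, Upsilon varpi phi &
        forall x, dotnorm ip (x - xbar) <= delta ->
          (h xbar < h x)%E -> (h x < h xbar + varpi)%E ->
          (1 <= (derive1 phi (fine (h x) - fine (h xbar)))%:E
                * dist0 ip (limiting_subdiff ip h x))%E].

(* Main.v *)
From HB Require Import structures.
Require Import Defs.
From mathcomp Require Import ring lra.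

Set Implicit Arguments.
Unset Strict Implicit.
Unset Printing Implicit Defensive.

Local Open Scope classical_set_scope.
Local Open Scope ring_scope.

(** Write [Theta] for the objective, [a k] for the norm of the accepted step,
    [xb] for a cluster point of [x], [t k] for [Theta (x k) - Theta xb] and [H k]
    for the potential at [u k] minus [Theta xb]. Then [t] decreases to 0 and,
    because [c_tilde >= mu_max], [t k.+1 + gamma_bar / 2 * a k ^+ 2 <= H k], while
    [H k <= t k + O (a k ^+ 2)]. The potential itself need not decrease along
    [u], so the desingularizing function [phi] is evaluated along [t] and the
    slope bound is transferred from [H k] to [t k.+1], where [phi'] is larger by
    concavity.

    The slope at [u k] is [O (a k)] near [xb]: stationarity of the model over the
    tangent space gives a subgradient [y] of [theta] and a normal vector [xi], and
    in a chart [psi] the pair [(xi, xi)] is, up to [O (a k)], normal to the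
    tangent bundle at [(x k, vbar k)].

    With [1 <= phi' (H k) * C * a k], this gives
    [a k.+1 <= a k / 2 + C' * (phi (t k.+1) - phi (t k.+2))] whenever [x k] is near
    [xb], and telescoping keeps the iterates there. *)

(** * Desingularizing functions and trapping *)

(** No calculus rule for limiting subdifferentials is used: the subgradient at [u k] is the gradient
    of an explicit differentiable minorant of the potential that touches it there. The difficulty is
    the indicator of the tangent bundle, which is only C^1. The covector [xi] is read in the chart
    and frozen as [beta]; then [beta (psi z) + beta ('d psi z v)] is differentiable in [(z, v)] and
    vanishes on the whole bundle near [x k]. Adding it to the minorant cancels every part of the
    gradient that does not tend to 0 with the step; what it adds instead is a second derivative of
    [psi] multiplied by [vbar k].

    The KL inequality at [u k] involves [a k], while the decrease from [t k.+1] to [t k.+2] controls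
    [a k.+1]. This shift of the index is what produces a recursion, and the arithmetic-geometric
    inequality gives it the contraction factor 1/2. The KL property is invoked at one point only,
    the limit of the [u k] along a subsequence of iterates tending to [xb]; both of its step
    components are 0, so the potential there equals [Theta xb]. *)

Lemma near0_scale (R : realType) (X : normedModType R) (w : X) (P : set X) :
  (\forall h \near (0 : X), P h) ->
  exists s : R, [/\ 0 < s, s <= 1 & P (s *: w)].
Proof.
move=> /nbhs_norm0P [d d0 Pd].
have w1 : 0 < 1 + `|w| by rewrite ltr_pwDl.
exists (Num.min 1 (d / (1 + `|w|) / 2)); split.
- by rewrite lt_min ltr01 !divr_gt0.
- by rewrite ge_min lexx.
apply: Pd => /=; rewrite normrZ ger0_norm; last first.
  by rewrite le_min ler01 !divr_ge0 // ltW.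
have dw : 0 < d / (1 + `|w|) by rewrite divr_gt0.
apply: (@le_lt_trans _ _ ((d / (1 + `|w|) / 2) * `|w|)).
  by rewrite ler_wpM2r // ge_min lexx orbT.
have := normr_ge0 w; have dE : d / (1 + `|w|) * (1 + `|w|) = d.
  by rewrite divfK // gt_eqF.
nra.
Qed.

Lemma convex_functionP (R : realType) (E : lmodType R) (D : set E)
    (f : E -> R) : convex_function D f ->
  forall (s : R) (x y : E), 0 <= s -> s <= 1 -> D x -> D y ->
  f (s *: x + (1 - s) *: y) <= s * f x + (1 - s) * f y.
Proof.
move=> cf s x y s0 s1 Dx Dy.
by have := cf (Itv01 s0 s1) x y (mem_set Dx) (mem_set Dy).
Qed.

Lemma derivable1_near (R : realType) (phi : R -> R) (a : R) :
  derivable phi a 1 -> forall eps : R, 0 < eps ->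
  \forall h \near (0 : R), `|phi (h + a) - phi a - h * derive1 phi a| <= eps * `|h|.
Proof.
move=> /derivable_nbhs /eqaddoP df eps e0.
have := df eps e0; apply: filterS => h /=.
rewrite derive1E !fctE /= opprD addrA /GRing.scale /= mulr1.
by [].
Qed.

(** If the tangent at [a] were exceeded at [b] by [gap], concavity would make it exceeded by at
    least [s * gap] at [a + s * (b - a)], against the [o(s)] of differentiability. The derivative is
    taken at [a] alone, so [b] may be the endpoint 0. *)
Lemma concave_tangent (R : realType) (D : set R) (phi : R -> R) (a b : R) :
  convex_function (D : set R^o) (fun t => - phi t) -> D a -> D b ->
  derivable phi a 1 -> phi b - phi a <= derive1 phi a * (b - a).
Proof.
move=> cphi Da Db dphi.
rewrite leNgt; apply/negP => lt.
set gap := phi b - phi a - derive1 phi a * (b - a).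
have gap0 : 0 < gap by rewrite subr_gt0.
have ba : 0 < 1 + `|b - a| by rewrite ltr_pwDl.
have e0 : 0 < gap / (1 + `|b - a|) by rewrite divr_gt0.
have [s [s0 s1 /=]] := near0_scale (b - a : R^o) (derivable1_near dphi e0).
rewrite /GRing.scale /= normrM (gtr0_norm s0).
have /= := @convex_functionP R R^o _ _ cphi s b a (ltW s0) s1 Db Da.
rewrite /GRing.scale /=.
have -> : s * b + (1 - s) * a = s * (b - a) + a by ring.
rewrite ler_norml => h1 /andP[_ h2].
have gE : gap / (1 + `|b - a|) * (1 + `|b - a|) = gap by rewrite divfK // gt_eqF.
have h3 : s * gap <= gap / (1 + `|b - a|) * (s * `|b - a|).
  by apply: le_trans h2; rewrite /gap; lra.
have : s * (gap / (1 + `|b - a|)) <= 0.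
  have -> : s * (gap / (1 + `|b - a|)) =
    s * gap - gap / (1 + `|b - a|) * (s * `|b - a|) by rewrite -{2}gE; ring.
  by rewrite subr_le0.
by rewrite leNgt mulr_gt0.
Qed.

Lemma near0_lt_ereal (R : realType) (varpi : \bar R) : (0 < varpi)%E ->
  \forall z \near (0 : R), (z%:E < varpi)%E.
Proof.
case: varpi => [w||] //= w0; last by near=> z; rewrite ltry.
by near=> z; rewrite lte_fin; near: z; exact: lt_nbhsl.
Unshelve. all: by end_near. Qed.

(** Adding the two tangent inequalities between [t] and [h] shows that [phi'] does not increase from
    [t] to [h]; the tangent at [t] then bounds [phi t']. *)
Lemma Upsilon_descent (R : realType) (varpi : \bar R) (phi : R -> R)
    (h t t' : R) : Upsilon varpi phi -> (0 < t)%R -> t <= h ->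
  (h%:E < varpi)%E -> 0 <= t' -> t' <= t ->
  derive1 phi h * (t - t') <= phi t - phi t'.
Proof.
case=> _ cphi _ _ dphi t0 th hv t'0 t't.
have tv : (t%:E < varpi)%E by apply: le_lt_trans hv; rewrite lee_fin.
have t'v : (t'%:E < varpi)%E by apply: le_lt_trans tv; rewrite lee_fin.
have h0 : 0 < h by apply: lt_le_trans th.
have [dt _ _] := dphi _ t0 tv.
have [dh _ _] := dphi _ h0 hv.
have Dt : [set t : R | 0 <= t /\ (t%:E < varpi)%E] t by split => //; apply: ltW.
have Dh : [set t : R | 0 <= t /\ (t%:E < varpi)%E] h by split => //; apply: ltW.
have Dt' : [set t : R | 0 <= t /\ (t%:E < varpi)%E] t' by [].
have ct := concave_tangent cphi Dt Dt' dt.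
have cth := concave_tangent cphi Dt Dh dt.
have cht := concave_tangent cphi Dh Dt dh.
have : derive1 phi h <= derive1 phi t.
  have [<-//|tneh] := eqVneq t h.
  have tlth : t < h by rewrite lt_neqAle tneh.
  have : (derive1 phi t - derive1 phi h) * (h - t) >= 0 by lra.
  by rewrite pmulr_lge0 ?subr_gt0 // subr_ge0.
nra.
Qed.

(** [phi] is continuous at 0 only relative to its domain, so the sequence has to be placed there: it
    is nonnegative and eventually below [varpi]. *)
Lemma Upsilon_cvg0 (R : realType) (varpi : \bar R) (phi : R -> R)
    (t : nat -> R) : Upsilon varpi phi -> (0 < varpi)%E ->
  (forall k, 0 <= t k) -> t @ \oo --> 0 ->
  (fun k => phi (t k)) @ \oo --> 0.
Proof.
case=> cphi _ _ phi0 _ v0 t0 tl.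
have D0 : [set s : R | 0 <= s /\ (s%:E < varpi)%E] 0 by [].
have cv : phi @ (within [set t | 0 <= t /\ (t%:E < varpi)%E] (nbhs (0 : R)))
    --> (0 : R).
  rewrite -[X in _ --> X]phi0.
  exact: (@subspace_continuousP _ _ _ _).1 cphi _ D0.
apply: (cvg_comp _ _ _ cv) => A /= nA.
have : \forall k \near \oo, [set t : R | 0 <= t /\ (t%:E < varpi)%E] (t k).
  have tv : \forall k \near \oo, ((t k)%:E < varpi)%E.
    exact: tl _ (near0_lt_ereal v0).
  by apply: filterS tv => k tk; split.
move=> H; have := tl _ nA; apply: filterS2 H => k Dk; exact.
Qed.

(* The quantity [`|x n - xb| + 2 M a n + 2 M C s n.+1] is nonincreasing as long
   as [x] stays in the ball, so once small it traps [x] there. *)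
Lemma trapping (R : realType) (X : normedModType R) (x : nat -> X) (xb : X)
    (a s : nat -> R) (M C rho : R) (K0 : nat) :
  0 <= M -> 0 <= C -> 0 < rho ->
  (forall k, 0 <= a k) -> (forall k, 0 <= s k) ->
  a @ \oo --> 0 -> s @ \oo --> 0 ->
  (forall k, (K0 <= k)%N -> `|x k.+1 - x k| <= M * a k) ->
  (forall k, (K0 <= k)%N -> `|x k - xb| < rho ->
     a k.+1 <= a k / 2 + C * (s k.+1 - s k.+2)) ->
  cluster (x @ \oo) xb ->
  x @ \oo --> xb /\
  exists B : R, forall n, \sum_(1 <= k < n) `|x k.+1 - x k| <= B.
Proof.
move=> M0 C0 rho0 a0 s0 al sl xM rec cl.
pose q n := 2 * M * a n + 2 * M * C * s n.+1.
have q0 n : 0 <= q n by rewrite addr_ge0 // !mulr_ge0.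
have ql : q @ \oo --> 0.
  rewrite -[0](_ : 2 * M * 0 + 2 * M * C * 0 = 0); last by rewrite !mulr0 addr0.
  by apply: cvgD; apply: cvgMr => //; rewrite (cvg_shiftS s).
have start r : 0 < r ->
    exists N, (K0 <= N)%N /\ `|x N - xb| + q N < r.
  move=> r0.
  have r20 : 0 < r / 2 by rewrite divr_gt0.
  move/cvgrPdist_lt: ql => /(_ _ r20) [N1 _ qN1].
  have nb : nbhs (x @ \oo) [set y | exists k, (maxn K0 N1 <= k)%N /\ y = x k].
    by exists (maxn K0 N1) => // k /= hk; exists k.
  have nbx : nbhs xb [set y | `|y - xb| < r / 2].
    by apply/nbhs_normP; exists (r / 2) => // y; rewrite /ball_ /= distrC.
  have [y [[k [hk ->]] /= hy]] := cl _ _ nb nbx.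
  exists k; split; first by apply: leq_trans hk; rewrite leq_maxl.
  have := qN1 k; rewrite /= sub0r normrN ger0_norm // => /(_ _).
  have -> : (N1 <= k)%N by apply: leq_trans hk; rewrite leq_maxr.
  move=> /(_ erefl); lra.
(* Length and distance are bounded together: the recursion is available at the next index only
   because the distance bound keeps the current iterate in the ball. *)
have inv N : (K0 <= N)%N -> `|x N - xb| + q N < rho -> forall n,
    \sum_(N <= k < N + n) `|x k.+1 - x k| + q (N + n)%N <= q N /\
    `|x (N + n)%N - xb| + q (N + n)%N <= `|x N - xb| + q N.
  move=> hN hq; elim=> [|n [IH1 IH2]].
    by rewrite addn0 big_geq // add0r.
  have hk : (K0 <= N + n)%N by rewrite (leq_trans hN) // leq_addr.
  have inb : `|x (N + n)%N - xb| < rho.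
    by apply: le_lt_trans hq; apply: le_trans IH2; rewrite lerDl.
  have r1 := rec _ hk inb.
  have r2 := xM _ hk.
  (* This is the recursion times [2 * M]: the loss [M * a (N + n)] of [q] pays for the length of the
     step. *)
  have qS : q (N + n).+1 + M * a (N + n)%N <= q (N + n)%N.
    by rewrite /q; nra.
  have tri : `|x (N + n).+1 - xb| <= `|x (N + n).+1 - x (N + n)%N| + `|x (N + n)%N - xb|.
    by apply: le_trans (ler_normD _ _); rewrite addrA subrK.
  rewrite addnS big_nat_recr ?leq_addr //=; split; lra.
split.
  apply/cvgrPdist_lt => eps e0.
  have r0 : 0 < Num.min eps rho by rewrite lt_min e0.
  have [N [hN]] := start _ r0; rewrite lt_min => /andP[h1 h2].
  exists N => // k /= Nk.
  have [_] := inv N hN h2 (k - N)%N; rewrite subnKC // => h3.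
  rewrite distrC; apply: le_lt_trans h1; apply: le_trans h3.
  by rewrite lerDl.
have [N [hN hq]] := start _ rho0.
(* The cut is at [N.+1] and not at [N], which may be 0 and so lie below the lower index 1. The term
   [k = N], which the bound from [inv] contains in addition, is nonnegative and dropped. *)
exists (\sum_(1 <= k < N.+1) `|x k.+1 - x k| + q N) => n.
have [nN|Nn] := leqP n N.+1.
  apply: (@le_trans _ _ (\sum_(1 <= k < N.+1) `|x k.+1 - x k|)); last first.
    by rewrite lerDl.
  case: n nN => [|n] nN; first by rewrite big_geq // sumr_ge0.
  rewrite [leRHS](@big_cat_nat _ _ _ n.+1) //= lerDl.
  by rewrite big_nat_cond sumr_ge0.
rewrite (big_cat_nat (n := N.+1)) //=; last exact: ltnW.
rewrite lerD2l.
have [h _] := inv N hN hq (n - N)%N.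
move: h; rewrite subnKC; last by apply: ltnW; apply: ltnW.
rewrite (@big_ltn _ _ _ N n); last exact: ltnW.
have := q0 n; have := normr_ge0 (x N.+1 - x N); lra.
Qed.

(** * Inner products and convex functions *)

Section InnerProduct.
Variables (R : realType) (X : normedModType R) (ip : {dot X for idfun}).
Hypothesis hX : induced_norm ip.

Lemma ipC u v : ip u v = ip v u.
Proof. by rewrite hermC expr0 mul1r. Qed.

Lemma ipDr u v w : ip u (v + w) = ip u v + ip u w.
Proof. exact: linearDr. Qed.

Lemma ipZr a u v : ip u (a *: v) = a * ip u v.
Proof. exact: linearZr_LR. Qed.

Lemma ipDl u v w : ip (u + v) w = ip u w + ip v w.
Proof. exact: linearDl. Qed.

Lemma ipZl a u v : ip (a *: u) v = a * ip u v.
Proof. exact: linearZl_LR. Qed.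

Lemma ipNr u v : ip u (- v) = - ip u v.
Proof. exact: linearNr. Qed.

Lemma ipNl u v : ip (- u) v = - ip u v.
Proof. exact: linearNl. Qed.

Lemma ip0r u : ip u 0 = 0.
Proof. exact: linear0r. Qed.

Lemma ip_sqr u : ip u u = `|u| ^+ 2.
Proof.
rewrite hX sqr_sqrtr //; have [->|u0] := eqVneq u 0; first by rewrite ip0r.
by apply/ltW/neq0_dnorm_gt0.
Qed.

Lemma ip_le u v : `|ip u v| <= `|u| * `|v|.
Proof.
have [->|v0] := eqVneq v 0; first by rewrite ip0r !normr0 mulr0.
have nv : 0 < `|v| by rewrite normr_gt0.
have nv2 : 0 < `|v| ^+ 2 by rewrite exprn_gt0.
rewrite -ler_sqr ?nnegrE ?mulr_ge0 // real_normK ?num_real // exprMn.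
have : 0 <= ip (u - (ip u v / `|v| ^+ 2) *: v) (u - (ip u v / `|v| ^+ 2) *: v).
  by rewrite ip_sqr sqr_ge0.
rewrite !(ipDl, ipDr, ipNl, ipNr, ipZl, ipZr) !ip_sqr (ipC v u).
set c := ip u v; set n := `|v| ^+ 2.
have -> : `|u| ^+ 2 - c / n * c + (- (c / n * c) - - (c / n * (c / n * n))) =
   `|u| ^+ 2 - c ^+ 2 / n by field; rewrite gt_eqF.
by rewrite subr_ge0 ler_pdivrMr.
Qed.

Section Basis.
Variables (p : nat) (e : 'I_p -> X).
Hypothesis he : orthonormal_basis ip e.

Lemma basis_norm i : `|e i| = 1.
Proof. by rewrite hX (he.1 i i) eqxx sqrtr1. Qed.

Lemma coord_le i u : `|ip (e i) u| <= `|u|.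
Proof. by have := ip_le (e i) u; rewrite basis_norm mul1r. Qed.

Lemma scalar_expand (l : X -> R) : scalar l ->
  forall u, l u = \sum_i ip (e i) u * l (e i).
Proof.
move=> hl u; pose L : {scalar X} := HB.pack l (GRing.isLinear.Build _ _ _ _ l hl).
rewrite -[l]/(L : X -> R) {1}(he.2 u) linear_sum /=.
by apply: eq_bigr => i _; exact: (linearZ_LR L).
Qed.

Lemma linear_expand (Y : normedModType R) (T : X -> Y) : linear T ->
  forall u, T u = \sum_i ip (e i) u *: T (e i).
Proof.
move=> hl u; pose L : {linear X -> Y} := HB.pack T (GRing.isLinear.Build _ _ _ _ T hl).
rewrite -[T]/(L : X -> Y) {1}(he.2 u) linear_sum /=.
by apply: eq_bigr => i _; exact: (linearZ_LR L).
Qed.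

Lemma riesz (l : X -> R) : scalar l ->
  forall u, ip (\sum_i l (e i) *: e i) u = l u.
Proof.
move=> hl u; rewrite (scalar_expand hl) linear_sumlz.
by apply: eq_bigr => i _; apply: etrans (ipZl _ _ _) _; rewrite mulrC.
Qed.

Lemma linear_norm_le (Y : normedModType R) (T : X -> Y) : linear T ->
  forall u, `|T u| <= (\sum_i `|T (e i)|) * `|u|.
Proof.
move=> hT u; rewrite (linear_expand hT); apply: le_trans (ler_norm_sum _ _ _) _.
rewrite mulr_suml; apply: ler_sum => i _.
by rewrite normrZ mulrC ler_wpM2l // coord_le.
Qed.

Lemma opnorm_ub (Y : normedModType R) (T : X -> Y) : linear T ->
  forall u, `|u| <= 1 -> `|T u| <= opnorm T.
Proof.
move=> hT u hu; apply: ub_le_sup; last by exists u.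
exists (\sum_i `|T (e i)|) => _ [w /= hw <-].
apply: le_trans (linear_norm_le hT w) _.
by rewrite ler_piMr // sumr_ge0.
Qed.

Lemma opnorm_ge0 (Y : normedModType R) (T : X -> Y) : linear T -> 0 <= opnorm T.
Proof. by move=> hT; apply: le_trans (opnorm_ub hT (u := 0) _); rewrite ?normr0. Qed.

End Basis.
End InnerProduct.

Lemma sup_nonneg (R : realType) (A : set R) : (forall y, A y -> 0 <= y) -> 0 <= sup A.
Proof.
move=> hA; have [[[y Ay] hs]|] := pselect (has_sup A); last by move=> /sup_out ->.
exact: le_trans (hA _ Ay) (ub_le_sup hs Ay).
Qed.

Section Convex.
Variables (R : realType) (Z : normedModType R) (ip : {dot Z for idfun}).
Variables (r : nat) (d : 'I_r -> Z) (theta : Z -> R).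
Hypotheses (hZ : induced_norm ip) (hd : orthonormal_basis ip d).
Hypothesis ctheta : convex_function [set: Z] theta.

Lemma midpointE (z w : Z) : (1 / 2) *: (z + w) + (1 - 1 / 2) *: (z - w) = z.
Proof.
have -> : 1 - 1 / 2 = 1 / 2 :> R by field.
rewrite -scalerDr addrACA subrr addr0 -[in RHS](scale1r z) -mulr2n.
by rewrite -(scaler_nat 2 z) scalerA mul1r mulVf.
Qed.

Lemma convex_comb_le s x y : 0 <= s -> s <= 1 ->
  theta (s *: x + (1 - s) *: y) <= s * theta x + (1 - s) * theta y.
Proof. by move=> s0 s1; apply: (convex_functionP ctheta). Qed.

(* On the span of finitely many coordinates, [c *: d i] with [|c| <= 1] is a
   convex combination of [d i] and [- d i]. *)
Lemma convex_box_bound (s : seq 'I_r) (z0 : Z) :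
  exists C : R, forall c : 'I_r -> R, (forall i, `|c i| <= 1) ->
    theta (z0 + \sum_(i <- s) c i *: d i) <= C.
Proof.
elim: s z0 => [|i s IH] z0.
  by exists (theta z0) => c _; rewrite big_nil addr0.
have [C1 h1] := IH (z0 + d i); have [C2 h2] := IH (z0 - d i).
exists (Num.max C1 C2) => c hc; rewrite big_cons.
have := hc i; rewrite ler_norml => /andP[l1 l2].
set S := \sum_(_ <- s) _.
have -> : z0 + (c i *: d i + S) = ((1 + c i) / 2) *: (z0 + d i + S) +
   (1 - (1 + c i) / 2) *: (z0 - d i + S).
  rewrite !scalerDr.
  have -> (u v w u' v' w' : Z) : u + v + w + (u' + v' + w') =
      (u + u') + (v + v') + (w + w').
    by rewrite (addrACA (u + v)) (addrACA u).
  rewrite -!scalerDl scalerN -scalerBl.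
  have -> : (1 + c i) / 2 + (1 - (1 + c i) / 2) = 1 by ring.
  have -> : (1 + c i) / 2 - (1 - (1 + c i) / 2) = c i by field.
  by rewrite !scale1r addrA.
apply: le_trans (convex_comb_le _ _ _ _) _; [lra|lra|].
have b1 : theta (z0 + d i + S) <= Num.max C1 C2 by rewrite le_max h1.
have b2 : theta (z0 - d i + S) <= Num.max C1 C2 by rewrite le_max h2 ?orbT.
nra.
Qed.

(** Above, coordinates are bounded by the norm, so the box bound applies. Below, [z0] is the
    midpoint of [z0 + w] and [z0 - w], whence the bound [2 * theta z0 - C]. *)
Lemma convex_ball_bound (z0 : Z) :
  exists C : R, forall w, `|w| <= 1 -> `|theta (z0 + w)| <= C.
Proof.
have [C hC] := convex_box_bound (index_enum 'I_r) z0.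
have ub w : `|w| <= 1 -> theta (z0 + w) <= C.
  move=> hw; rewrite (hd.2 w); apply: hC => i.
  exact: le_trans (coord_le hZ hd _ _) hw.
exists (Num.max C (C - 2 * theta z0)) => w hw.
rewrite ler_norml; apply/andP; split; last by rewrite le_max ub.
have := ub (- w); rewrite normrN => /(_ hw) h1.
have half : 0 <= 1 / 2 :> R /\ 1 / 2 <= 1 :> R by split; lra.
have := convex_comb_le (z0 + w) (z0 - w) half.1 half.2.
rewrite midpointE.
have : C - 2 * theta z0 <= Num.max C (C - 2 * theta z0) by rewrite le_max lexx orbT.
lra.
Qed.

Definition subgradient (z y : Z) :=
  forall w, theta z + ip y w <= theta (z + w).

(** The subgradient inequality is tested along [y] at length 1/2: [z] and the test point both stay
    in the unit ball around [z0], where [theta] varies by at most [2 * C]. The bound is uniform in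
    [z] because the linearized points move with [k]. *)
Lemma subgradient_bound (z0 : Z) :
  exists C : R, forall z y, `|z - z0| <= 1 / 2 -> subgradient z y -> `|y| <= C.
Proof.
have [C hC] := convex_ball_bound z0; exists (4 * C) => z y hz hy.
have [->|y0] := eqVneq y 0.
  by rewrite normr0 mulr_ge0 //; apply: le_trans (hC 0 _); rewrite ?normr0.
have ny : 0 < `|y| by rewrite normr_gt0.
have := hy ((2 * `|y|)^-1 *: y); rewrite ipZr ip_sqr //.
have -> : (2 * `|y|)^-1 * `|y| ^+ 2 = `|y| / 2 by field; rewrite gt_eqF.
have nw : `|(2 * `|y|)^-1 *: y| = 1 / 2.
  by rewrite normrZ ger0_norm ?invr_ge0 ?mulr_ge0 //; field; rewrite gt_eqF.
have := hC (z - z0); rewrite subrKC => /(_ _) h1.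
have := hC (z - z0 + (2 * `|y|)^-1 *: y); rewrite addrA subrKC => h2.
have {}h1 : `|theta z| <= C by apply: h1; lra.
have {}h2 : `|theta (z + (2 * `|y|)^-1 *: y)| <= C.
  apply: h2; apply: le_trans (ler_normD _ _) _; rewrite nw; lra.
move: h1 h2; rewrite !ler_norml => /andP[? ?] /andP[? ?]; lra.
Qed.

(** Convexity along rays from [z0] turns the bound [C] on the unit sphere into an upper estimate
    linear in the norm of [w]; the midpoint inequality reflects it into a lower one. *)
Lemma convex_continuous (z0 : Z) : {for z0, continuous theta}.
Proof.
have [C hC] := convex_ball_bound z0.
have C0 : 0 <= C by apply: le_trans (hC 0 _); rewrite ?normr0.
have lip w : `|w| <= 1 -> theta (z0 + w) - theta z0 <= 2 * C * `|w|.
  move=> hw; have [->|w0] := eqVneq w 0.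
    by rewrite addr0 subrr normr0 mulr0.
  have nw : 0 < `|w| by rewrite normr_gt0.
  have := convex_comb_le (z0 + `|w|^-1 *: w) z0 (ltW nw) hw.
  have -> : `|w| *: (z0 + `|w|^-1 *: w) + (1 - `|w|) *: z0 = z0 + w.
    rewrite scalerDr scalerA divff ?gt_eqF // scale1r addrAC -scalerDl.
    by rewrite subrKC scale1r.
  have := hC (`|w|^-1 *: w); rewrite normrZ normfV normr_id mulVf ?gt_eqF //.
  have := hC 0; rewrite normr0 addr0 => /(_ ler01) + /(_ (lexx _)).
  rewrite !ler_norml => /andP[? ?] /andP[? ?]; nra.
apply/cvgrPdist_lt => eps e0.
have dl : 0 < Num.min 1 (eps / (2 * C + 1)).
  by rewrite lt_min ltr01 divr_gt0 // ltr_pwDr // mulr_ge0.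
near=> z.
have : `|z - z0| < Num.min 1 (eps / (2 * C + 1)).
  near: z; apply/nbhs_normP; exists (Num.min 1 (eps / (2 * C + 1))) => // z.
  by rewrite /ball_ /= distrC.
rewrite lt_min ltr_pdivlMr ?ltr_pwDr ?mulr_ge0 // => /andP[h1 h2].
have l1 := lip _ (ltW h1); rewrite subrKC in l1.
have l2 : theta z0 - theta z <= 2 * C * `|z - z0|.
  have := lip (- (z - z0)); rewrite normrN => /(_ (ltW h1)).
  have half : 0 <= 1 / 2 :> R /\ 1 / 2 <= 1 :> R by split; lra.
  have := convex_comb_le (z0 + (z - z0)) (z0 - (z - z0)) half.1 half.2.
  rewrite midpointE subrKC.
  lra.
have := normr_ge0 (z - z0) => zz.
rewrite distrC lter_norml; apply/andP; split; nra.
Unshelve. all: by end_near. Qed.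

End Convex.

(** * Hahn-Banach extension and multipliers in finite dimension *)

Section HahnBanach.
Variables (R : realType) (Z : normedModType R) (ip : {dot Z for idfun}).
Variables (r : nat) (d : 'I_r -> Z) (theta : Z -> R).
Hypothesis hd : orthonormal_basis ip d.
Hypothesis ctheta : convex_function [set: Z] theta.

(* [G] is the graph of a linear functional on a subspace, lying below the
   increments of [theta] at [z]. *)
Definition dominated_graph (z : Z) (G : Z -> R -> Prop) :=
  [/\ G 0 0,
      forall a w1 m1 w2 m2, G w1 m1 -> G w2 m2 -> G (a *: w1 + w2) (a * m1 + m2) &
      forall w m, G w m -> theta z + m <= theta (z + w)].

(** The value at the new direction [v] must lie above all backward difference quotients of [theta]
    along [v] and below all forward ones. By convexity the former never exceed the latter, so the
    supremum of the backward ones will do. *)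
Lemma dominated_graph_extend1 z G v : dominated_graph z G ->
  exists G' c, [/\ dominated_graph z G', forall w m, G w m -> G' w m & G' v c].
Proof.
case=> G0 Glin Gdom.
pose S := [set c | exists w m t, [/\ 0 < t, G w m &
  c = (m - (theta (z + (w - t *: v)) - theta z)) / t]].
have cross c : S c -> forall w m s, 0 < s -> G w m ->
    c <= (theta (z + (w + s *: v)) - theta z - m) / s.
  move=> [w1 [m1 [t [t0 G1 ->]]]] w2 m2 s s0 G2.
  have st0 : 0 < s + t by rewrite addr_gt0.
  have stn : s + t != 0 by rewrite gt_eqF.
  (* The weights [t / (s + t)] and [s / (s + t)] make the components along [v] cancel, which leaves
     a point governed by [G]. *)
  have := convex_comb_le ctheta (z + (w2 + s *: v)) (z + (w1 - t *: v))
    (s := t / (s + t)) _ _.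
  have -> : 1 - t / (s + t) = s / (s + t) by field.
  have -> : (t / (s + t)) *: (z + (w2 + s *: v)) +
    (s / (s + t)) *: (z + (w1 - t *: v)) =
    z + ((t / (s + t)) *: w2 + (s / (s + t)) *: w1).
    rewrite !scalerDr addrACA -scalerDl.
    have -> : t / (s + t) + s / (s + t) = 1 by field.
    rewrite scale1r addrACA scalerN !scalerA.
    have -> : t / (s + t) * s = s / (s + t) * t by ring.
    by rewrite subrr addr0.
  have G12 : G ((t / (s + t)) *: w2 + (s / (s + t)) *: w1)
      (t / (s + t) * m2 + s / (s + t) * m1).
    apply: (Glin) => //.
    by rewrite -[_ *: w1]addr0 -[_ * m1]addr0; apply: Glin.
  have := Gdom _ _ G12.
  set q := theta (z + _); set q2 := theta (z + (w2 + s *: v)).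
  set q1 := theta (z + (w1 - t *: v)) => h1 h2.
  have {}h2 : q <= t / (s + t) * q2 + s / (s + t) * q1.
    apply: h2; first by rewrite divr_ge0 ?ltW.
    by rewrite ler_pdivrMr // mul1r lerDr ltW.
  have h3 : theta z + (t / (s + t) * m2 + s / (s + t) * m1) <=
    t / (s + t) * q2 + s / (s + t) * q1 by apply: le_trans h2.
  rewrite ler_pdivrMr // mulrAC ler_pdivlMr //.
  have : (s + t) * (theta z + (t / (s + t) * m2 + s / (s + t) * m1)) <=
     (s + t) * (t / (s + t) * q2 + s / (s + t) * q1) by rewrite ler_pM2l.
  have -> : (s + t) * (theta z + (t / (s + t) * m2 + s / (s + t) * m1)) =
    (s + t) * theta z + t * m2 + s * m1 by field.
  have -> : (s + t) * (t / (s + t) * q2 + s / (s + t) * q1) =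
    t * q2 + s * q1 by field.
  lra.
have S0 : S !=set0 by eexists; exists 0, 0, 1; split => //; reflexivity.
have Sub : has_ubound S.
  by eexists => c Sc; apply: (cross c Sc 0 0 1).
pose c := sup S.
exists (fun w m => exists w' m' s, [/\ G w' m', w = w' + s *: v & m = m' + s * c]), c.
split.
- split.
  + by exists 0, 0, 0; rewrite scale0r mul0r !addr0.
  + move=> a _ _ _ _ [w1 [m1 [s1 [g1 -> ->]]]] [w2 [m2 [s2 [g2 -> ->]]]].
    exists (a *: w1 + w2), (a * m1 + m2), (a * s1 + s2); split.
    * exact: Glin.
    * by rewrite scalerDr scalerDl scalerA addrACA.
    * by ring.
  + move=> _ _ [w [m [s [g -> ->]]]].
    have [s0|s0|->] := ltgtP s 0; last first.
    * by rewrite scale0r mul0r !addr0; apply: Gdom.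
    * have : c <= (theta (z + (w + s *: v)) - theta z - m) / s.
        by apply: ge_sup => // c' Sc'; apply: cross.
      rewrite ler_pdivlMr //; lra.
    * have t0 : 0 < - s by rewrite oppr_gt0.
      have : (m - (theta (z + (w - (- s) *: v)) - theta z)) / (- s) <= c.
        by apply: ub_le_sup => //; exists w, m, (- s).
      rewrite ler_pdivrMr // scaleNr opprK; lra.
- by move=> w m g; exists w, m, 0; rewrite scale0r mul0r !addr0.
- by exists 0, 0, 1; rewrite scale1r mul1r !add0r.
Qed.

(** Induction over the finite basis takes the place of Zorn's lemma. *)
Lemma dominated_graph_extend z G (s : seq 'I_r) : dominated_graph z G ->
  exists G', [/\ dominated_graph z G', forall w m, G w m -> G' w m &
    forall i, i \in s -> exists c, G' (d i) c].
Proof.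
move=> hG; elim: s => [|i s [G1 [h1 h2 h3]]]; first by exists G.
have [G2 [c [k1 k2 k3]]] := dominated_graph_extend1 (d i) h1.
exists G2; split => // [w m /h2 /k2 //|j].
rewrite in_cons => /orP[/eqP ->|/h3 [c' /k2 ?]]; first by exists c.
by exists c'.
Qed.

Lemma subgradient_extend z G : dominated_graph z G ->
  exists y, subgradient ip theta z y /\ forall w m, G w m -> ip y w = m.
Proof.
move=> /(dominated_graph_extend (index_enum 'I_r)) [G' [[G0 Glin Gdom] GG' Gd]].
have /choice [c hc] i : exists c, G' (d i) c by apply: Gd; rewrite mem_index_enum.
pose y := \sum_i c i *: d i.
have Gy w : G' w (ip y w).
  have -> : ip y w = \sum_i ip (d i) w * c i.
    rewrite /y linear_sumlz; apply: eq_bigr => i _.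
    by apply: etrans (ipZl _ _ _ _) _; rewrite mulrC.
  rewrite {1}(hd.2 w); elim: (index_enum _) => [|i s IH].
    by rewrite !big_nil.
  by rewrite !big_cons; apply: Glin.
exists y; split => [w|w m /GG' g]; first exact/Gdom/Gy.
(* [G'] is a relation; that it has a single value at [w] follows from domination, since every real
   multiple of its value [ip y w - m] at 0 is at most 0. *)
have g0 : G' 0 (ip y w - m).
  have -> : ip y w - m = -1 * m + ip y w by ring.
  have -> : (0 : Z) = -1 *: w + w by rewrite scaleN1r addNr.
  exact: Glin.
have sc a : a * (ip y w - m) <= 0.
  have := Glin a _ _ _ _ g0 G0; rewrite scaler0 !addr0 => /Gdom.
  by rewrite addr0 gerDl.
apply/eqP; rewrite -subr_eq0 eq_le; have := sc 1; have := sc (-1).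
by rewrite mul1r mulN1r oppr_le0 => -> ->.
Qed.

End HahnBanach.

(** The pairs [(A u, l u)] with [u] in [T] form a dominated graph; that [l u] depends on [A u] alone
    is a consequence of domination. *)
Lemma subspace_multiplier (R : realType) (X Z : normedModType R)
    (ip : {dot Z for idfun}) (r : nat) (d : 'I_r -> Z) (theta : Z -> R)
    (T : set X) (A : X -> Z) (l : X -> R) (z : Z) :
  orthonormal_basis ip d -> convex_function [set: Z] theta ->
  T 0 -> (forall a u v, T u -> T v -> T (a *: u + v)) ->
  linear A -> scalar l ->
  (forall u, T u -> theta z + l u <= theta (z + A u)) ->
  exists y, subgradient ip theta z y /\ forall u, T u -> ip y (A u) = l u.
Proof.
move=> hd ctheta T0 Tlin hA hl dom.
have A0 : A 0 = 0.
  have := hA 1 0 0; rewrite scaler0 addr0 scale1r => /eqP.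
  by rewrite -subr_eq0 opprD addNKr oppr_eq0 => /eqP.
have l0 : l 0 = 0 by have := hl 1 0 0; rewrite scaler0 addr0 mul1r; lra.
have dg : dominated_graph theta z
    (fun w m => exists2 u, T u & w = A u /\ m = l u).
  split.
  - by exists 0 => //; rewrite A0 l0.
  - move=> a _ _ _ _ [u1 T1 [-> ->]] [u2 T2 [-> ->]].
    by exists (a *: u1 + u2); [exact: Tlin|rewrite hA hl].
  - by move=> _ _ [u Tu [-> ->]]; apply: dom.
have [y [hy yG]] := subgradient_extend hd ctheta dg.
by exists y; split => // u Tu; apply: yG; exists u.
Qed.

(** * Tangent spaces in slice charts *)

Lemma diff_near_le (R : realType) (X Y : normedModType R) (f : X -> Y) (x : X) :
  differentiable f x -> forall eps : R, 0 < eps ->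
  \forall y \near x, `|f y - f x - 'd f x (y - x)| <= eps * `|y - x|.
Proof.
move=> /diff_locally /eqaddoP df eps e0.
have /nbhs_norm0P [dl dl0 hd] := df eps e0.
apply/nbhs_normP; exists dl => // y; rewrite /ball_ /= distrC => /hd /=.
by rewrite !fctE /= subrK opprD addrA.
Qed.

Lemma diff_left_inverse (R : realType) (X : normedModType R) (f g : X -> X) (x : X) :
  differentiable f x -> differentiable g (f x) ->
  (\forall y \near x, g (f y) = y) -> forall u, 'd g (f x) ('d f x u) = u.
Proof.
move=> df dg gf u.
have dgf := differentiable_comp df dg.
have -> : 'd g (f x) ('d f x u) = 'd (g \o f) x u.
  exact: (congr1 (fun h : X -> X => h u) (esym (diff_comp df dg))).
rewrite -deriveE // (@near_eq_derive _ _ _ (g \o f) id) //.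
exact: derive_val.
Qed.

Section Chart.
Variables (R : realType) (X : normedModType R) (ip : {dot X for idfun}).
Hypothesis hX : induced_norm ip.
Variables (p : nat) (e : 'I_p -> X) (M : set X) (n : nat).
Variables (U V : set X) (psi chi : X -> X).
Hypotheses (oU : open U) (oV : open V) (psiC : Ck 2 U psi) (chiC : Ck 2 V chi).
Hypotheses (psiUV : psi @` U = V) (psiK : forall y, U y -> chi (psi y) = y).
Hypothesis MU : forall y, U y ->
  (M y <-> forall i : 'I_p, (n <= i)%N -> ip (e i) (psi y) = 0).

Lemma psiV y : U y -> V (psi y).
Proof. by move=> Uy; rewrite -psiUV; exists y. Qed.

Lemma chiK w : V w -> psi (chi w) = w /\ U (chi w).
Proof. by rewrite -psiUV => -[y Uy <-]; rewrite psiK. Qed.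

Lemma dchi_dpsi y : U y -> forall u, 'd chi (psi y) ('d psi y u) = u.
Proof.
move=> Uy; apply: diff_left_inverse; first exact: psiC.1.
  by apply: chiC.1; apply: psiV.
by apply: filterS (open_nbhs_nbhs (conj oU Uy)) => z; exact: psiK.
Qed.

Lemma dpsi_dchi y : U y -> forall w, 'd psi y ('d chi (psi y) w) = w.
Proof.
move=> Uy w; have := @diff_left_inverse _ _ chi psi (psi y).
rewrite psiK // => -> //; first by apply: chiC.1; apply: psiV.
  exact: psiC.1.
by apply: filterS (open_nbhs_nbhs (conj oV (psiV Uy))) => z /chiK [].
Qed.

(** Along the curve the last coordinates of [psi] vanish identically, hence so does their
    derivative; the expansion at one small parameter [s] bounds it by an arbitrary [eps']. *)
Lemma tangent_dpsi y v : U y -> tangent M y v ->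
  forall i : 'I_p, (n <= i)%N -> ip (e i) ('d psi y v) = 0.
Proof.
move=> Uy [eps [c [eps0 [dc _] Mc c0 c'0]]] i ni.
have dc0 : differentiable (c : R -> X) (0 : R) by apply: dc; rewrite /= normr0.
have dpc : differentiable (psi \o c) (0 : R).
  by apply: differentiable_comp => //; rewrite c0; exact: psiC.1.
have dE : 'd (psi \o c) (0 : R) 1 = 'd psi y v.
  by rewrite diff_comp //= ?c0 -?c'0 ?derive1E' //; exact: psiC.1.
have zero : \forall t \near (0 : R), ip (e i) (psi (c t)) = 0.
  have : \forall t \near (0 : R), U (c t).
    apply: (differentiable_continuous dc0); rewrite c0.
    exact: open_nbhs_nbhs.
  have : \forall t \near (0 : R), `|t| < eps.
    by apply/nbhs_norm0P; exists eps.
  by apply: filterS2 => t ht Uct; apply: (MU Uct).1 => //; exact: Mc.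
apply/eqP; rewrite -normr_le0; apply/ler_addgt0Pr => eps' e'0; rewrite add0r.
have e2 : 0 < eps' / (1 + `|e i|) by rewrite divr_gt0 // ltr_pwDl.
have [s [s0 s1 [h1 h2]]] :=
  near0_scale (1 : R^o) (filterI zero (diff_near_le dpc e2)).
move: h1 h2; rewrite /GRing.scale /= mulr1 subr0 c0 => h1.
have -> : 'd (psi \o c) (0 : R) s = s *: 'd psi y v.
  by rewrite -dE -linearZ /= /GRing.scale /= mulr1.
have h0 : ip (e i) (psi y) = 0 by rewrite -c0; apply: nbhs_singleton zero.
move=> h2.
have : `|ip (e i) (psi (c s) - psi y - s *: 'd psi y v)| <=
    `|e i| * (eps' / (1 + `|e i|) * `|s|).
  by apply: le_trans (ip_le hX _ _) _; rewrite ler_wpM2l.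
rewrite !(ipDr, ipNr) ipZr h1 h0 subr0 add0r normrN normrM (gtr0_norm s0).
have := normr_ge0 (e i) => ee.
have eE : eps' / (1 + `|e i|) * (1 + `|e i|) = eps'.
  by rewrite divfK // gt_eqF // ltr_pwDl.
move=> h; rewrite -(ler_pM2l s0); apply: le_trans h _.
have -> : s * eps' = (1 + `|e i|) * (eps' / (1 + `|e i|) * s) by rewrite -{1}eE; ring.
by apply: ler_wpM2r; rewrite ?ler_wpDl // mulr_ge0 // ltW.
Qed.

(** The curve is the image under [chi] of the straight line through [psi y] with direction
    ['d psi y v], which stays in the slice. *)
Lemma dpsi_tangent y v : U y -> M y ->
  (forall i : 'I_p, (n <= i)%N -> ip (e i) ('d psi y v) = 0) -> tangent M y v.
Proof.
move=> Uy My hv; pose w := 'd psi y v; pose l (t : R) := psi y + t *: w.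
have dl t : is_diff t l ( *:%R^~ w).
  rewrite /l; have -> : *:%R^~ w = (cst 0 : R -> X) + *:%R^~ w.
    by apply/funext => s; rewrite fctE add0r.
  exact: is_diffD.
have lc t : {for t, continuous l} by exact: differentiable_continuous.
have : \forall t \near (0 : R), V (l t).
  apply: lc; rewrite /l scale0r addr0; apply: open_nbhs_nbhs; split => //.
  exact: psiV.
move=> /nbhs_norm0P [eps /= eps0 Vl].
have dchil t : `|t| < eps -> differentiable (chi \o l) t.
  by move=> /Vl Vlt; apply: differentiable_comp => //; exact: chiC.1.
have dE t s : `|t| < eps -> 'd (chi \o l) t s = s *: 'd chi (l t) w.
  move=> ht; rewrite diff_comp //; last by apply: chiC.1; apply: Vl.
  by rewrite /= diff_val linearZ.
exists eps, (chi \o l); split => //.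
- split => [//|s t /= ht].
  have [_ /(_ w) [dchi _]] := chiC.
  have cw : {for l t, continuous (fun z => 'd chi z w)}.
    by apply: differentiable_continuous; apply: dchi; exact: Vl.
  have cs : {for t, continuous (fun t => s *: 'd chi (l t) w)}.
    apply: continuousZl_tmp.
    exact: (@continuous_comp _ _ _ l (fun z => 'd chi z w) t).
  apply/cvgrPdist_lt => eta eta0.
  have near_t : \forall t' \near t, `|t'| < eps.
    apply/nbhs_normP; exists (eps - `|t|); first by rewrite /= subr_gt0.
    move=> t'; rewrite /ball_ /= => tt'.
    have := ler_normB t (t - t'); rewrite subKr; lra.
  have /cvgrPdist_lt /(_ _ eta0) := cs.
  apply: filterS2 near_t => t' ht' /=.
  by rewrite -[s *: 'd chi (l t) w](dE t s ht) -[s *: 'd chi (l t') w](dE t' s ht').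
- move=> t ht; have [psichi Uchi] := chiK (Vl _ ht).
  apply/(MU Uchi) => i ni; rewrite /= psichi /l ipDr ipZr.
  by rewrite hv // ((MU Uy).1 My) // mulr0 addr0.
- by rewrite /= /l scale0r addr0 psiK.
- rewrite derive1E'; last by apply: dchil; rewrite normr0.
  by rewrite dE ?normr0 // scale1r /l scale0r addr0 dchi_dpsi.
Qed.

Lemma tangent_chart y v : U y -> M y -> tangent M y v <->
  (forall i : 'I_p, (n <= i)%N -> ip (e i) ('d psi y v) = 0).
Proof. by move=> Uy My; split; [apply: tangent_dpsi|apply: dpsi_tangent]. Qed.

(** Curves do not show stability under addition; in the chart the tangent space is the common kernel
    of finitely many linear forms. *)
Lemma tangent_linear y : U y -> M y ->
  tangent M y 0 /\ forall a u v, tangent M y u -> tangent M y v ->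
    tangent M y (a *: u + v).
Proof.
move=> Uy My; split=> [|a u v tu tv]; apply/tangent_chart => // i ni.
  by rewrite linear0 ip0r.
rewrite linearD linearZ ipDr ipZr (tangent_dpsi Uy tu) //.
by rewrite (tangent_dpsi Uy tv) // mulr0 add0r.
Qed.

End Chart.

(** * Subgradients of the potential *)

Section Fder.
Variables (R : realType) (E : zmodType) (N : E -> R).
Hypothesis N0 : forall y, 0 <= N y.

(* Fréchet differentiability measured by [N]; the space on which the potential
   lives is normed by [dotnorm] and not by the norm the library puts on it. *)
Definition fder (h g : E -> R) (w : E) : Prop :=
  (exists C, forall y, `|g y| <= C * N y) /\
  forall eps : R, 0 < eps -> exists2 delta : R, 0 < delta &
    forall y, N (y - w) < delta -> `|h y - h w - g (y - w)| <= eps * N (y - w).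

Lemma fder_ext h h' g g' w : h =1 h' -> g =1 g' -> fder h g w -> fder h' g' w.
Proof. by move=> /funext <- /funext <-. Qed.

Lemma fder_cst c w : fder (fun=> c) (fun=> 0) w.
Proof.
split; first by exists 0 => y; rewrite normr0 mul0r.
by move=> eps e0; exists 1 => // y _; rewrite !subrr normr0 mulr_ge0 // ltW.
Qed.

Lemma fderD h1 g1 h2 g2 w : fder h1 g1 w -> fder h2 g2 w ->
  fder (fun y => h1 y + h2 y) (fun y => g1 y + g2 y) w.
Proof.
move=> [[C1 b1] d1] [[C2 b2] d2]; split.
  exists (C1 + C2) => y; rewrite mulrDl.
  by apply: le_trans (ler_normD _ _) _; apply: lerD.
move=> eps e0; have e2 : 0 < eps / 2 by rewrite divr_gt0.
have [r1 r10 h1'] := d1 _ e2; have [r2 r20 h2'] := d2 _ e2.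
exists (Num.min r1 r2) => [|y]; rewrite lt_min ?r10 // => /andP[/h1' l1 /h2' l2].
have -> : h1 y + h2 y - (h1 w + h2 w) - (g1 (y - w) + g2 (y - w)) =
  (h1 y - h1 w - g1 (y - w)) + (h2 y - h2 w - g2 (y - w)) by ring.
apply: le_trans (ler_normD _ _) _; lra.
Qed.

Lemma fderZ c h g w : fder h g w -> fder (fun y => c * h y) (fun y => c * g y) w.
Proof.
move=> [[C b] d]; split.
  by exists (`|c| * C) => y; rewrite normrM -mulrA ler_wpM2l.
move=> eps e0; have cp : 0 < 1 + `|c| by rewrite ltr_pwDl.
have e2 : 0 < eps / (1 + `|c|) by rewrite divr_gt0.
have [r r0 hr] := d _ e2; exists r => // y /hr l.
have -> : c * h y - c * h w - c * g (y - w) = c * (h y - h w - g (y - w)) by ring.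
rewrite normrM; apply: le_trans (ler_wpM2l _ l) _ => //.
have eE : eps / (1 + `|c|) * (1 + `|c|) = eps by rewrite divfK // gt_eqF.
rewrite -[X in _ <= X * _]eE mulrA; apply: ler_wpM2r => //.
by rewrite mulrC; apply: ler_wpM2l; [exact: ltW|rewrite lerDr].
Qed.

Lemma fder_sum (I : Type) (s : seq I) (h g : I -> E -> R) w :
  (forall i, fder (h i) (g i) w) ->
  fder (fun y => \sum_(i <- s) h i y) (fun y => \sum_(i <- s) g i y) w.
Proof.
move=> hi; elim: s => [|i s IH].
  by apply: fder_ext (fder_cst 0 w) => y; rewrite big_nil.
by apply: fder_ext (fderD (hi i) IH) => y; rewrite big_cons.
Qed.

(** The remainder is that of the combination [h1 w * h2 + h2 w * h1] plus the product of the two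
    increments, which is of second order. *)
Lemma fderM h1 g1 h2 g2 w : fder h1 g1 w -> fder h2 g2 w ->
  fder (fun y => h1 y * h2 y) (fun y => h1 w * g2 y + h2 w * g1 y) w.
Proof.
move=> H1 H2; have [b12 d12] := fderD (fderZ (h1 w) H2) (fderZ (h2 w) H1).
split=> // eps e0; case: H1 H2 => [[C1 b1] d1] [[C2 b2] d2].
have C10 : 0 <= `|C1| + 1 by rewrite addr_ge0.
have C20 : 0 <= `|C2| + 1 by rewrite addr_ge0.
have [r1 r10 l1] := d1 _ (ltr01 : 0 < 1 :> R).
have [r2 r20 l2] := d2 _ (ltr01 : 0 < 1 :> R).
have e2 : 0 < eps / 2 by rewrite divr_gt0.
have [r3 r30 l3] := d12 _ e2.
pose K := (`|C1| + 1) * (`|C2| + 1).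
have K0 : 0 <= K by rewrite mulr_ge0.
have r40 : 0 < eps / 2 / (1 + K) by rewrite divr_gt0 // ltr_pwDl.
exists (Num.min (Num.min r1 r2) (Num.min r3 (eps / 2 / (1 + K)))).
  by rewrite !lt_min r10 r20 r30.
move=> y; rewrite !lt_min => /andP[/andP[/l1 m1 /l2 m2] /andP[/l3 m3 m4]].
set n := N (y - w) in m1 m2 m3 m4 *.
have n0 : 0 <= n by exact: N0.
have q1 : `|h1 y - h1 w| <= (`|C1| + 1) * n.
  have -> : h1 y - h1 w = g1 (y - w) + (h1 y - h1 w - g1 (y - w)) by ring.
  apply: le_trans (ler_normD _ _) _; rewrite mulrDl; apply: lerD => //.
  apply: le_trans (b1 _) _; apply: ler_wpM2r => //; exact: ler_norm.
have q2 : `|h2 y - h2 w| <= (`|C2| + 1) * n.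
  have -> : h2 y - h2 w = g2 (y - w) + (h2 y - h2 w - g2 (y - w)) by ring.
  apply: le_trans (ler_normD _ _) _; rewrite mulrDl; apply: lerD => //.
  apply: le_trans (b2 _) _; apply: ler_wpM2r => //; exact: ler_norm.
have -> : h1 y * h2 y - h1 w * h2 w - (h1 w * g2 (y - w) + h2 w * g1 (y - w)) =
  (h1 w * h2 y + h2 w * h1 y - (h1 w * h2 w + h2 w * h1 w) -
   (h1 w * g2 (y - w) + h2 w * g1 (y - w))) +
  (h1 y - h1 w) * (h2 y - h2 w) by ring.
apply: le_trans (ler_normD _ _) _.
have -> : eps * n = eps / 2 * n + eps / 2 * n by field.
apply: lerD => //; rewrite normrM.
apply: le_trans (ler_pM _ _ q1 q2) _ => //.
rewrite mulrACA -/K mulrA; apply: ler_wpM2r => //.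
move: m4; rewrite ltr_pdivlMr ?ltr_pwDl // => m4; nra.
Qed.

Lemma fder_bilinear (B : E -> E -> R) (C : R) w :
  (forall u v t, B (u + v) t = B u t + B v t) ->
  (forall u v t, B t (u + v) = B t u + B t v) ->
  (forall u v, `|B u v| <= C * (N u * N v)) ->
  fder (fun y => B y y) (fun y => B w y + B y w) w.
Proof.
move=> Bl Br hB; split.
  exists (2 * C * N w) => y; apply: le_trans (ler_normD _ _) _.
  have := hB w y; have := hB y w; nra.
move=> eps e0; have Cp : 0 < 1 + `|C| by rewrite ltr_pwDl.
exists (eps / (1 + `|C|)); first by rewrite divr_gt0.
move=> y; rewrite ltr_pdivlMr // => ny.
set t := y - w in ny *; set n := N t in ny *.
have -> : B y y = B w w + B w t + (B t w + B t t).
  have yE : y = w + t by rewrite addrC subrK.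
  by rewrite {1 2}yE Bl !Br.
have -> : B w w + B w t + (B t w + B t t) - B w w - (B w t + B t w) = B t t.
  by ring.
apply: le_trans (hB _ _) _; rewrite -/n mulrA.
have n0 : 0 <= n by exact: N0.
apply: ler_wpM2r => //; have := ler_norm C; nra.
Qed.

Lemma fder_linear (g : E -> R) (C : R) w :
  (forall u v, g (u - v) = g u - g v) ->
  (forall u, `|g u| <= C * N u) -> fder g g w.
Proof.
move=> ga gb; split; first by exists C.
by move=> eps e0; exists 1 => // y _; rewrite ga subrr normr0 mulr_ge0 // ltW.
Qed.

(** Carries ordinary differentiability on a factor [X] over to [N] on the product: the projection
    [pi] does not increase norms. *)
Lemma fder_comp (X Y : normedModType R) (ip : {dot X for idfun}) (p : nat)
    (e : 'I_p -> X) (pi : E -> X) (f : X -> Y) (l : Y -> R) (C : R) w :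
  induced_norm ip -> orthonormal_basis ip e ->
  (forall u v, pi (u - v) = pi u - pi v) -> (forall u, `|pi u| <= N u) ->
  (forall u v, l (u - v) = l u - l v) -> (forall u, `|l u| <= C * `|u|) ->
  differentiable f (pi w) ->
  fder (fun y => l (f (pi y))) (fun y => l ('d f (pi w) (pi y))) w.
Proof.
move=> hX he pia pib la lb df.
have lb' u : `|l u| <= (1 + `|C|) * `|u|.
  by apply: le_trans (lb u) _; apply: ler_wpM2r => //; have := ler_norm C; lra.
have C0 : 0 < 1 + `|C| by rewrite ltr_pwDl.
split.
  exists ((1 + `|C|) * \sum_i `|'d f (pi w) (e i)|) => y.
  apply: le_trans (lb' _) _; rewrite -mulrA; apply: ler_wpM2l; first exact: ltW.
  apply: le_trans (linear_norm_le hX he (linearP _) _) _.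
  by apply: ler_wpM2l => //; exact: sumr_ge0.
move=> eps e0; have e1 : 0 < eps / (1 + `|C|) by rewrite divr_gt0.
have /nbhs_normP [dl dl0 hd] := diff_near_le df e1.
exists dl => // y ny; rewrite pia -!la.
apply: le_trans (lb' _) _; rewrite mulrC -ler_pdivlMr //.
apply: le_trans (hd _ _) _.
  by rewrite /ball_ /= distrC -pia; apply: le_lt_trans ny.
rewrite mulrAC; apply: ler_wpM2r; first by rewrite invr_ge0 ltW.
by apply: ler_wpM2l; [exact: ltW|rewrite -pia].
Qed.

End Fder.

Section Subdiff.
Variables (R : realType) (E : lmodType R) (dot : E -> E -> R).

(** A function that lies below [h] near [w] and touches it there passes its gradient on to [h]. *)
Lemma fder_regular_subdiff (h : E -> \bar R) (Phi g : E -> R) (w G : E) :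
  h w = (Phi w)%:E ->
  (exists2 d0 : R, 0 < d0 & forall y, dotnorm dot (y - w) < d0 ->
    ((Phi y)%:E <= h y)%E) ->
  fder (dotnorm dot) Phi g w -> (forall y, dot G y = g y) ->
  regular_subdiff dot h w G.
Proof.
move=> hw [d0 d00 low] [_ df] hG; split; first by rewrite hw.
move=> eps /df [d1 d10 hd]; exists (Num.min d0 d1); first by rewrite lt_min d00.
move=> y; rewrite lt_min => /andP[/low lowy /hd dy].
apply: le_trans lowy; rewrite hw hG -EFinD lee_fin.
by move: dy; rewrite ler_norml => /andP[+ _]; lra.
Qed.

Lemma regular_limiting (h : E -> \bar R) (w : E) : dot 0 0 = 0 ->
  regular_subdiff dot h w `<=` limiting_subdiff dot h w.
Proof.
move=> dot0 G hG; split; first by case: hG.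
have n0 : dotnorm dot 0 = 0 by rewrite /dotnorm dot0 sqrtr0.
exists (fun=> w), (fun=> G); split => //; rewrite ?subrr ?n0; exact: cvg_cst.
Qed.

Lemma dist0_le (C : set E) (G : E) : C G -> (dist0 dot C <= (dotnorm dot G)%:E)%E.
Proof. by move=> CG; apply: ereal_inf_lbound; exists G. Qed.

End Subdiff.

(** * The Euclidean norm on the domain of the potential *)

Section PotentialDot.
Variables (R : realType) (X : normedModType R) (ip : {dot X for idfun}).
Hypothesis hX : induced_norm ip.
Variables (p r : nat).

Local Notation E := (X * X * 'M[R]_(r, p) * X * X)%type.
Local Notation N := (dotnorm (potential_dot ip (p := p) (r := r))).

Lemma mx_dotE (A B : 'M[R]_(r, p)) : mx_dot A B = \sum_i \sum_j A i j * B i j.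
Proof.
rewrite /mx_dot /mxtrace exchange_big /=; apply: eq_bigr => j _; rewrite mxE.
by apply: eq_bigr => i _; rewrite mxE.
Qed.

Lemma mx_dot_ge0 (A : 'M[R]_(r, p)) : 0 <= mx_dot A A.
Proof. by rewrite mx_dotE; do 2! apply: sumr_ge0 => ? _; rewrite -expr2 sqr_ge0. Qed.

Lemma potential_sqr (x v s t : X) (Q : 'M[R]_(r, p)) :
  potential_dot ip (x, v, Q, s, t) (x, v, Q, s, t) =
  `|x| ^+ 2 + `|v| ^+ 2 + mx_dot Q Q + `|s| ^+ 2 + `|t| ^+ 2.
Proof. by rewrite /potential_dot /prod_dot /= !ip_sqr. Qed.

Lemma potential_norm_ge0 y : 0 <= N y.
Proof. exact: sqrtr_ge0. Qed.

Lemma sqr_le_potential_norm a (y : E) : a ^+ 2 <= potential_dot ip y y ->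
  `|a| <= N y.
Proof. by move=> h; rewrite -sqrtr_sqr; apply: ler_wsqrtr. Qed.

Lemma potential_norm_comp (x v s t : X) (Q : 'M[R]_(r, p)) :
  [/\ `|x| <= N (x, v, Q, s, t), `|v| <= N (x, v, Q, s, t),
    `|s| <= N (x, v, Q, s, t), `|t| <= N (x, v, Q, s, t) &
    forall i j, `|Q i j| <= N (x, v, Q, s, t)].
Proof.
have := sqr_ge0 `|x|; have := sqr_ge0 `|v|; have := sqr_ge0 `|s|.
have := sqr_ge0 `|t|; have := mx_dot_ge0 Q => ? ? ? ? ?.
have le y : y ^+ 2 <= `|x| ^+ 2 + `|v| ^+ 2 + mx_dot Q Q + `|s| ^+ 2 + `|t| ^+ 2 ->
    `|y| <= N (x, v, Q, s, t).
  by move=> h; apply: sqr_le_potential_norm; rewrite potential_sqr.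
split; [rewrite -[`|x|]normr_id|rewrite -[`|v|]normr_id|
  rewrite -[`|s|]normr_id|rewrite -[`|t|]normr_id|move=> i j];
  apply: le; try lra.
have : Q i j ^+ 2 <= mx_dot Q Q; last lra.
rewrite mx_dotE (bigD1 i) //= (bigD1 j) //= -expr2 -addrA lerDl.
by apply: addr_ge0; last apply: sumr_ge0 => k _; apply: sumr_ge0 => ? _;
  rewrite -expr2 sqr_ge0.
Qed.

Lemma potential_norm_le (x v s t : X) (Q : 'M[R]_(r, p)) (B : R) : 0 <= B ->
  mx_dot Q Q <= B ^+ 2 -> N (x, v, Q, s, t) <= `|x| + `|v| + B + `|s| + `|t|.
Proof.
move=> B0 hB.
have := normr_ge0 x; have := normr_ge0 v; have := normr_ge0 s.
have := normr_ge0 t => t0 s0 v0 x0.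
have S0 : 0 <= `|x| + `|v| + B + `|s| + `|t| by lra.
rewrite -(ger0_norm S0) -sqrtr_sqr; apply: ler_wsqrtr.
rewrite potential_sqr.
set a := `|x| in x0 S0 *; set b := `|v| in v0 S0 *.
set c := `|s| in s0 S0 *; set d := `|t| in t0 S0 *.
have -> : (a + b + B + c + d) ^+ 2 = a ^+ 2 + b ^+ 2 + B ^+ 2 + c ^+ 2 + d ^+ 2 +
  2 * (a * (b + B + c + d) + b * (B + c + d) + B * (c + d) + c * d) by ring.
have : 0 <= 2 * (a * (b + B + c + d) + b * (B + c + d) + B * (c + d) + c * d).
  by rewrite mulr_ge0 // !addr_ge0 // mulr_ge0 // ?addr_ge0.
lra.
Qed.

Lemma potential_dot0 : potential_dot ip (p := p) (r := r) 0 0 = 0.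
Proof.
have := potential_sqr 0 0 0 0 0; rewrite mx_dotE normr0 => ->.
rewrite big1 ?expr0n /= ?addr0 // => i _; rewrite big1 // => j _.
by rewrite mxE mul0r.
Qed.

End PotentialDot.

Lemma gradientP (R : realType) (X : normedModType R) (ip : {dot X for idfun})
    (p : nat) (e : 'I_p -> X) (f : X -> R) (x : X) :
  orthonormal_basis ip e -> forall v, ip (gradient ip f x) v = 'd f x v.
Proof.
move=> he; have := @xgetPex _ 0 [set g : X | forall v, ip g v = 'd f x v].
apply; exists (\sum_i 'd f x (e i) *: e i) => v.
exact: (riesz he (linearP _)).
Qed.

Lemma of_coords_diff_mx (R : realType) (X Z : normedModType R)
    (ip : {dot X for idfun}) (ipZ : {dot Z for idfun}) (p r : nat)
    (e : 'I_p -> X) (d : 'I_r -> Z) (F : X -> Z) (x v : X) :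
  orthonormal_basis ip e -> orthonormal_basis ipZ d ->
  of_coords d (diff_mx ipZ e d F x *m coords ip e v) = 'd F x v.
Proof.
move=> he hd; rewrite /of_coords [RHS](hd.2); apply: eq_bigr => i _; congr (_ *: _).
rewrite mxE (linear_expand he (linearP ('d F x))) linear_sumr.
by apply: eq_bigr => j _; rewrite !mxE mulrC; apply: etrans (esym (ipZr _ _ _ _)) _.
Qed.

(** * A differentiable minorant of the potential and its gradient *)

Section Potential.
Variables (R : realType) (X Z : normedModType R).
Variables (ip : {dot X for idfun}) (ipZ : {dot Z for idfun}).
Variables (p r : nat) (e : 'I_p -> X) (d : 'I_r -> Z).
Hypotheses (hX : induced_norm ip) (hZ : induced_norm ipZ).
Hypotheses (he : orthonormal_basis ip e) (hd : orthonormal_basis ipZ d).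
Variables (M : set X) (f : X -> \bar R) (theta : Z -> R) (F : X -> Z).
Hypothesis fgtNy : forall x, (-oo < f x)%E.
Hypothesis ffin : forall x, M x -> f x \is a fin_num.
Variables (n : nat) (U V : set X) (psi chi : X -> X).
Hypotheses (oU : open U) (oV : open V) (psiC : Ck 2 U psi) (chiC : Ck 2 V chi).
Hypotheses (psiUV : psi @` U = V) (psiK : forall y, U y -> chi (psi y) = y).
Hypothesis MU : forall y, U y ->
  (M y <-> forall i : 'I_p, (n <= i)%N -> ip (e i) (psi y) = 0).

Local Notation E := (X * X * 'M[R]_(r, p) * X * X)%type.
Local Notation dot := (potential_dot ip (p := p) (r := r)).
Local Notation N := (dotnorm dot).

Lemma potential_proj (y : E) :
  [/\ `|y.1.1.1.1| <= N y, `|y.1.1.1.2| <= N y, `|y.1.2| <= N y, `|y.2| <= N y &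
    forall i j, `|y.1.1.2 i j| <= N y].
Proof. by case: y => [[[[x v] Q] s] t]; exact: potential_norm_comp. Qed.

Lemma scalarB (l : X -> R) : scalar l -> forall u v, l (u - v) = l u - l v.
Proof. by move=> hl u v; rewrite addrC -scaleN1r hl; ring. Qed.

Variables (x vb eta q : X) (yy : Z) (Kxi Kchi Kpsi as_ c : R).
Hypotheses (Ux : U x) (Mx : M x) (tvb : tangent M x vb).
Hypotheses (df : differentiable (fine \o f) x) (dF : differentiable F x).
Let grad := gradient ip (fine \o f) x.
Hypothesis hyy : subgradient ipZ theta (F x + 'd F x vb) yy.
(** With [q] the image of [vb] under the metric of the iteration, [- xi] is the derivative at [vb]
    of the model in which [theta] is replaced by its affine minorant of slope [yy]; stationarity
    makes it vanish on the tangent space. *)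
Let xi u := - (ip grad u + ip q u + ipZ yy ('d F x u)).
Hypothesis xi0 : forall u, tangent M x u -> xi u = 0.
Hypothesis hKxi : forall u, `|xi u| <= Kxi * `|u|.
Hypothesis hKchi : forall w, `|'d chi (psi x) w| <= Kchi * `|w|.
Hypothesis hKpsi : forall j u, `|'d (fun z => 'd psi z (e j)) x u| <= Kpsi * `|u|.
Hypotheses (Kxi0 : 0 <= Kxi) (Kchi0 : 0 <= Kchi) (Kpsi0 : 0 <= Kpsi).

(** This is [xi] read in the chart and frozen at [x]. It vanishes on the slice, hence on [psi z] and
    ['d psi z v] for every [(z, v)] of the bundle with [z] in [U], not only at [z = x]. *)
Let beta w := xi ('d chi (psi x) w).

Let xi_scalar : scalar xi.
Proof.
move=> a u v; rewrite /xi (linearP ('d F x)) !ipDr !ipZr /=; ring.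
Qed.

Let beta_scalar : scalar beta.
Proof. by move=> a u v; rewrite /beta (linearP ('d chi (psi x))); exact: xi_scalar. Qed.

Let beta_bound w : `|beta w| <= Kxi * Kchi * `|w|.
Proof.
by apply: le_trans (hKxi _) _; rewrite -mulrA; apply: ler_wpM2l.
Qed.

Let beta0 w : (forall i : 'I_p, (n <= i)%N -> ip (e i) w = 0) -> beta w = 0.
Proof.
move=> hw; apply: xi0;
have tc := tangent_chart hX oU oV psiC chiC psiUV psiK MU.
apply/(tc _ _ Ux Mx).
by move=> i ni; rewrite (dpsi_dchi oV psiC chiC psiUV psiK Ux) hw.
Qed.

Let beta_dpsi u : beta ('d psi x u) = xi u.
Proof. by rewrite /beta (dchi_dpsi oU psiC chiC psiUV psiK Ux). Qed.

(** The expansion separates the variables: each summand is a linear form in [v] times a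
    differentiable function of [z], a product to which [fderM] applies. *)
Let beta_expand z v :
  \sum_j ip (e j) v * beta ('d psi z (e j)) = beta ('d psi z v).
Proof.
have sc : scalar (fun v => beta ('d psi z v)).
  by move=> a u w; rewrite (linearP ('d psi z)); exact: beta_scalar.
by rewrite (scalar_expand he sc).
Qed.

Let beta_tangent_bundle z v : U z -> tangent_bundle M (z, v) ->
  beta (psi z) + beta ('d psi z v) = 0.
Proof.
move=> Uz [Mz tv]; rewrite !beta0 ?addr0 // => i ni.
  exact: (tangent_dpsi hX oU psiC MU Uz tv).
exact: ((MU Uz).1 Mz).
Qed.

Let pair Q v := ipZ yy (of_coords d (Q *m coords ip e v)).

Let pairE (Q : 'M[R]_(r, p)) v :
  pair Q v = \sum_i \sum_j ipZ (d i) yy * (Q i j * ip (e j) v).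
Proof.
rewrite /pair /of_coords linear_sumr; apply: eq_bigr => i _.
apply: etrans (ipZr _ _ _ _) _; rewrite (ipC ipZ yy) mxE mulr_suml.
by apply: eq_bigr => j _; rewrite mxE mulrC.
Qed.

Let pairDl Q Q' v : pair (Q + Q') v = pair Q v + pair Q' v.
Proof.
rewrite !pairE -big_split; apply: eq_bigr => i _; rewrite -big_split.
by apply: eq_bigr => j _; rewrite mxE /=; ring.
Qed.

Let pairDr Q v v' : pair Q (v + v') = pair Q v + pair Q v'.
Proof.
rewrite !pairE -big_split; apply: eq_bigr => i _; rewrite -big_split.
by apply: eq_bigr => j _; rewrite ipDr /=; ring.
Qed.

Let px (y : E) : X := y.1.1.1.1.

(* The smooth minorant: [theta] is replaced by its affine minorant at the
   linearized point, and the indicator of the tangent bundle by the function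
   [beta (psi x') + beta (psi'(x') v')], which vanishes on the bundle. *)
Let Phi (y : E) : R :=
  fine (f (px y)) + ip y.1.2 y.1.1.1.2
  + (theta (F x + 'd F x vb) - ipZ yy (F x + 'd F x vb))
  + ipZ yy (F (px y)) + pair y.1.1.2 y.1.1.1.2
  + (beta (psi (px y))
     + \sum_j ip (e j) y.1.1.1.2 * beta ('d psi (px y) (e j)))
  + as_ / 2 * ip y.1.1.1.2 y.1.1.1.2 + c / 2 * ip y.2 y.2.

Let w : E := (x, vb, diff_mx ipZ e d F x, grad, eta).

Let g (y : E) : R :=
  'd (fine \o f) x (px y) + (ip grad y.1.1.1.2 + ip y.1.2 vb)
  + 0
  + ipZ yy ('d F x (px y))
  + (pair (diff_mx ipZ e d F x) y.1.1.1.2 + pair y.1.1.2 vb)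
  + (beta ('d psi x (px y))
     + \sum_j (ip (e j) vb * beta ('d (fun z => 'd psi z (e j)) x (px y))
               + beta ('d psi x (e j)) * ip (e j) y.1.1.1.2))
  + as_ / 2 * (ip vb y.1.1.1.2 + ip y.1.1.1.2 vb)
  + c / 2 * (ip eta y.2 + ip y.2 eta).

Let N_ge0 : forall y, 0 <= N y.
Proof. exact: potential_norm_ge0. Qed.

Let fder_Phi : fder N Phi g w.
Proof.
have projx (y : E) : `|y.1.1.1.1| <= N y by have [] := potential_proj y.
have projv (y : E) : `|y.1.1.1.2| <= N y by have [] := potential_proj y.
have projs (y : E) : `|y.1.2| <= N y by have [] := potential_proj y.
have proje (y : E) : `|y.2| <= N y by have [] := potential_proj y.
have projQ (y : E) i j : `|y.1.1.2 i j| <= N y.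
  by have [_ _ _ _] := potential_proj y; apply.
have ipb (u v : X) (a b : R) : `|u| <= a -> `|v| <= b -> `|ip u v| <= 1 * (a * b).
  by move=> ha hb; rewrite mul1r; apply: le_trans (ip_le hX _ _) _; exact: ler_pM.
rewrite /Phi /g; apply: fderD; last first.
  apply: (fderZ N_ge0).
  apply: (@fder_bilinear _ _ _ N_ge0 (fun a b : E => ip a.2 b.2) 1 w).
  - by move=> a b t; rewrite ipDl.
  - by move=> a b t; rewrite ipDr.
  - by move=> a b; exact: ipb.
apply: fderD; last first.
  apply: (fderZ N_ge0).
  apply: (@fder_bilinear _ _ _ N_ge0 (fun a b : E => ip a.1.1.1.2 b.1.1.1.2) 1 w).
  - by move=> a b t; rewrite ipDl.
  - by move=> a b t; rewrite ipDr.
  - by move=> a b; exact: ipb.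
apply: fderD; last first.
  apply: fderD.
    apply: (@fder_comp _ _ _ X X ip p e px psi beta
      (Kxi * Kchi) w hX he) => //.
      exact: scalarB.
    exact: psiC.1.
  apply: (fder_sum N_ge0) => j.
  apply: (@fderM _ _ _ N_ge0 (fun y : E => ip (e j) y.1.1.1.2)
    (fun y : E => ip (e j) y.1.1.1.2) (fun y => beta ('d psi (px y) (e j)))
    (fun y => beta ('d (fun z => 'd psi z (e j)) x (px y))) w).
    apply: (@fder_linear _ _ _ N_ge0 (fun y : E => ip (e j) y.1.1.1.2) 1).
      by move=> a b; rewrite /= ipDr ipNr.
    by move=> a; rewrite mul1r; apply: le_trans (coord_le hX he _ _) _.
  apply: (@fder_comp _ _ _ X X ip p e px
      (fun z => 'd psi z (e j)) beta (Kxi * Kchi) w hX he) => //.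
    exact: scalarB.
  exact: (psiC.2 (e j)).1.
apply: fderD; last first.
  apply: (@fder_bilinear _ _ _ N_ge0 (fun a b : E => pair a.1.1.2 b.1.1.1.2)
    (\sum_(i < r) \sum_(j < p) `|ipZ (d i) yy|) w).
  - by move=> a b t; exact: pairDl.
  - by move=> a b t; exact: pairDr.
  - move=> a b; rewrite pairE mulr_suml.
    apply: le_trans (ler_norm_sum _ _ _) _; apply: ler_sum => i _.
    rewrite mulr_suml; apply: le_trans (ler_norm_sum _ _ _) _; apply: ler_sum => j _.
    rewrite normrM; apply: ler_wpM2l => //; rewrite normrM; apply: ler_pM => //.
    by apply: le_trans (coord_le hX he _ _) _.
apply: fderD; last first.
  apply: (@fder_comp _ _ _ X Z ip p e px F (ipZ yy)
      `|yy| w hX he) => //.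
    by move=> a b; rewrite ipDr ipNr.
  by move=> a; exact: ip_le.
apply: fderD; last exact: (fder_cst N_ge0).
apply: fderD.
  apply: (@fder_comp _ _ _ X R ip p e px (fine \o f) id
      1 w hX he) => //.
  by move=> a; rewrite mul1r.
apply: (@fder_bilinear _ _ _ N_ge0 (fun a b : E => ip a.1.2 b.1.1.1.2) 1 w).
- by move=> a b t; rewrite ipDl.
- by move=> a b t; rewrite ipDr.
- by move=> a b; exact: ipb.
Qed.

Local Notation Xic := (Xi_c ip e d M f theta F as_ c).

Let Xi_w : Xic w = (Phi w)%:E.
Proof.
rewrite /Xi_c /Xi /w /Phi /= /indicator_fun asboolT // adde0.
rewrite -(fineK (ffin Mx)) -!EFinD; congr (_%:E).
rewrite of_coords_diff_mx // beta_expand beta_tangent_bundle //.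
rewrite /pair of_coords_diff_mx // !ipDr !(ip_sqr hX) /=; ring.
Qed.

(** Off the bundle the potential is [+oo]; on it the [beta] terms vanish and the subgradient
    inequality of [theta] remains. Closeness to [w] keeps the base point in the chart. *)
Let Phi_minorant : exists2 d0 : R, 0 < d0 & forall y, N (y - w) < d0 ->
  ((Phi y)%:E <= Xic y)%E.
Proof.
have /nbhs_normP [d0 d00 hU] := open_nbhs_nbhs (conj oU Ux).
exists d0 => // -[[[[x' v'] Q'] s'] e'] hN.
have Ux' : U x'.
  apply: hU; rewrite /ball_ /= distrC; apply: le_lt_trans hN.
  by have [] := potential_proj ((x', v', Q', s', e') - w).
rewrite /Xi_c /Xi /= /indicator_fun.
have [tb|ntb] := pselect (tangent_bundle M (x', v')); last first.
  rewrite asboolF // (_ : (_ + +oo)%E = +oo%E) ?leey // addey //.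
  by rewrite gt_eqF // lteNye adde_eq_ninfty negb_or -!ltNye fgtNy ltNyr.
rewrite asboolT // adde0 -(fineK (ffin tb.1)) -!EFinD lee_fin /Phi /=.
rewrite beta_expand beta_tangent_bundle // !(ip_sqr hX).
have := hyy (F x' + of_coords d (Q' *m coords ip e v') - (F x + 'd F x vb)).
rewrite subrKC ipDr ipNr ipDr -/(pair Q' v'); lra.
Qed.

(** The first component of the gradient after cancellation: [xi] removes the gradient of [f] and the
    adjoint of ['d F x] at [yy], leaving [- q] and a second derivative of [psi] multiplied by [vb].
    The same cancellation leaves [as_ *: vb - q] as the second component of [G]. *)
Let lx u := - ip q u
  + beta (\sum_j ip (e j) vb *: 'd (fun z => 'd psi z (e j)) x u).

Let lx_scalar : scalar lx.
Proof.
move=> a u v; rewrite /lx ipDr ipZr.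
have -> : \sum_j ip (e j) vb *: 'd (fun z => 'd psi z (e j)) x (a *: u + v) =
  a *: (\sum_j ip (e j) vb *: 'd (fun z => 'd psi z (e j)) x u) +
  \sum_j ip (e j) vb *: 'd (fun z => 'd psi z (e j)) x v.
  rewrite scaler_sumr -big_split; apply: eq_bigr => j _ /=.
  by rewrite (linearP ('d _ x)) /= scalerDr !scalerA mulrC.
rewrite beta_scalar; ring.
Qed.

Let G : E := (\sum_i lx (e i) *: e i, as_ *: vb - q,
  \matrix_(i, j) (ipZ (d i) yy * ip (e j) vb), vb, c *: eta).

Let dotG y : dot G y = g y.
Proof.
case: y => [[[[x' v'] Q'] s'] e'].
rewrite /potential_dot /prod_dot /G /g /= (riesz he lx_scalar) mx_dotE.
rewrite -(gradientP (fine \o f) x he).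
have -> : \sum_i \sum_j (\matrix_(i, j) (ipZ (d i) yy * ip (e j) vb)) i j * Q' i j =
  pair Q' vb.
  rewrite pairE; apply: eq_bigr => i _; apply: eq_bigr => j _.
  by rewrite mxE; ring.
rewrite big_split /= {2}/pair of_coords_diff_mx // beta_dpsi.
have -> : \sum_j beta ('d psi x (e j)) * ip (e j) v' = xi v'.
  by rewrite -beta_dpsi -beta_expand; apply: eq_bigr => j _; rewrite mulrC.
rewrite /lx.
have -> : beta (\sum_j ip (e j) vb *: 'd (fun z => 'd psi z (e j)) x x') =
  \sum_j ip (e j) vb * beta ('d (fun z => 'd psi z (e j)) x x').
  elim: (index_enum _) => [|j s IH].
    rewrite !big_nil; have := beta_scalar 1 0 0.
    by rewrite scaler0 addr0; lra.
  by rewrite !big_cons beta_scalar IH.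
rewrite /xi -/grad !(ipDl, ipNl, ipZl) (ipC ip v' vb) (ipC ip e' eta) (ipC ip s' vb).
by field.
Qed.

Let lx_bound u : `|lx u| <= (`|q| + Kxi * Kchi * (Kpsi * p%:R) * `|vb|) * `|u|.
Proof.
apply: le_trans (ler_normD _ _) _; rewrite normrN mulrDl; apply: lerD.
  exact: ip_le.
apply: le_trans (beta_bound _) _; rewrite -!mulrA.
do 2! apply: ler_wpM2l => //.
apply: le_trans (ler_norm_sum _ _ _) _.
have -> : Kpsi * (p%:R * (`|vb| * `|u|)) = \sum_(j < p) `|vb| * (Kpsi * `|u|).
  by rewrite sumr_const card_ord -mulr_natl; ring.
apply: ler_sum => j _; rewrite normrZ; apply: ler_pM => //.
exact: coord_le.
Qed.

Lemma Xi_subgradient : exists H : E, limiting_subdiff dot Xic w H /\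
  N H <= (2 * `|q| + (Kxi * Kchi * (Kpsi * p%:R) + `|as_| + `|yy| + 1) * `|vb|)
         + `|c| * `|eta|.
Proof.
exists G; split.
  apply: (regular_limiting (potential_dot0 _ _ _)).
    exact: hX.
  exact: (fder_regular_subdiff Xi_w Phi_minorant fder_Phi dotG).
have B0 : 0 <= `|yy| * `|vb| by exact: mulr_ge0.
(* The matrix component has rank one, so by Parseval its norm is the product of the norms of [yy]
   and [vb]. *)
apply: le_trans (potential_norm_le hX _ _ _ _ B0 _) _.
  rewrite mx_dotE.
  have -> : \sum_(i < r) \sum_(j < p) (\matrix_(i, j) (ipZ (d i) yy * ip (e j) vb)) i j *
      (\matrix_(i, j) (ipZ (d i) yy * ip (e j) vb)) i j =
      (\sum_(i < r) ipZ (d i) yy * ipZ (d i) yy) *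
      (\sum_(j < p) ip (e j) vb * ip (e j) vb).
    rewrite mulr_suml; apply: eq_bigr => i _; rewrite mulr_sumr.
    by apply: eq_bigr => j _; rewrite !mxE; ring.
  have scZ : scalar (ipZ yy) by move=> a u v; rewrite ipDr ipZr.
  have scX : scalar (ip vb) by move=> a u v; rewrite ipDr ipZr.
  rewrite exprMn -(ip_sqr hX) -(ip_sqr hZ) (scalar_expand hd scZ) (scalar_expand he scX).
  rewrite le_eqVlt; apply/orP; left; apply/eqP; congr (_ * _).
    by apply: eq_bigr => i _; rewrite (ipC ipZ yy).
  by apply: eq_bigr => i _; rewrite (ipC ip vb).
have gx : `|\sum_i lx (e i) *: e i| <= `|q| + Kxi * Kchi * (Kpsi * p%:R) * `|vb|.
  set gx := \sum_i _; have [->|gx0] := eqVneq gx 0.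
    by rewrite normr0 addr_ge0 // !mulr_ge0.
  have ng : 0 < `|gx| by rewrite normr_gt0.
  rewrite -(ler_pM2r ng) -expr2 -(ip_sqr hX) (riesz he lx_scalar).
  exact: le_trans (ler_norm _) (lx_bound _).
have gv : `|as_ *: vb - q| <= `|as_| * `|vb| + `|q|.
  by apply: le_trans (ler_normB _ _) _; rewrite normrZ.
rewrite [`|c *: eta|]normrZ; lra.
Qed.

End Potential.

(** * Local estimates *)

Lemma locally_lipschitz_at (R : realType) (X : normedModType R) (V : zmodType)
    (nV : V -> R) (A : set X) (g : X -> V) (x : X) :
  locally_lipschitz nV A g -> A x ->
  exists2 L : R, 0 <= L & \forall y \near x, nV (g y - g x) <= L * `|y - x|.
Proof.
move=> lg Ax; have [L [[B C] /= [nB nC] hBC]] := lg _ Ax.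
exists `|L| => //; apply: filterS nB => y By.
apply: le_trans (hBC (y, x) _) _; first by split=> //; exact: nbhs_singleton nC.
by apply: ler_wpM2r => //=; exact: ler_norm.
Qed.

Lemma lipschitz_at_continuous (R : realType) (X Y : normedModType R)
    (g : X -> Y) (x : X) (L : R) :
  (\forall y \near x, `|g y - g x| <= L * `|y - x|) -> {for x, continuous g}.
Proof.
move=> /nbhs_normP [r /= r0 hg]; apply/cvgrPdist_lt => eps e0.
have Lp : 0 < 1 + `|L| by rewrite ltr_pwDl.
have m0 : 0 < Num.min r (eps / (1 + `|L|)) by rewrite lt_min r0 divr_gt0.
apply/nbhs_normP; exists (Num.min r (eps / (1 + `|L|))) => // y.
rewrite /ball_ /= lt_min => /andP[h1 h2].
rewrite distrC; apply: le_lt_trans (hg _ h1) _.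
move: h2; rewrite ltr_pdivlMr // distrC => h2.
have := ler_norm L; have := normr_ge0 (y - x); nra.
Qed.

Lemma continuous_bounded_near (R : realType) (X Y : normedModType R)
    (g : X -> Y) (x : X) : {for x, continuous g} ->
  exists2 C : R, 0 <= C & \forall y \near x, `|g y| <= C.
Proof.
move=> cg; exists (`|g x| + 1); first exact: addr_ge0.
move/cvgrPdist_lt: cg => /(_ _ ltr01); apply: filterS => y hy.
have := ler_normB (g x) (g x - g y); rewrite subKr; lra.
Qed.

(** A linear map is bounded through its values on the basis, so continuity of these finitely many
    values yields a bound uniform near [x]. *)
Lemma linear_bounded_near (R : realType) (X Y W : normedModType R)
    (ip : {dot Y for idfun}) (p : nat) (e : 'I_p -> Y) (T : X -> Y -> W) (x : X) :
  induced_norm ip -> orthonormal_basis ip e -> (forall z, linear (T z)) ->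
  (forall i, {for x, continuous (fun z => T z (e i))}) ->
  exists2 C : R, 0 <= C & \forall z \near x, forall u, `|T z u| <= C * `|u|.
Proof.
move=> hY he hT cT.
have /choice [C hC] i : exists C : R, 0 <= C /\ \forall z \near x, `|T z (e i)| <= C.
  by have [C] := continuous_bounded_near (cT i); exists C.
exists (\sum_i C i); first by apply: sumr_ge0 => i _; exact: (hC i).1.
have : \forall z \near x, forall i, `|T z (e i)| <= C i.
  by apply: filter_forall => i; exact: (hC i).2.
apply: filterS => z hz u; apply: le_trans (linear_norm_le hY he (hT z) u) _.
by apply: ler_wpM2r => //; apply: ler_sum.
Qed.

Lemma opnorm_basis_le (R : realType) (X Y : normedModType R)
    (ip : {dot X for idfun}) (p : nat) (e : 'I_p -> X) (T T' : {linear X -> Y}) i :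
  induced_norm ip -> orthonormal_basis ip e ->
  `|T (e i) - T' (e i)| <= opnorm ((T : X -> Y) - (T' : X -> Y)).
Proof.
move=> hX he; have hl : linear ((T : X -> Y) - (T' : X -> Y)).
  move=> a u v; rewrite -[LHS]/(T (a *: u + v) - T' (a *: u + v)).
  rewrite -[RHS]/(a *: (T u - T' u) + (T v - T' v)) (linearP T) (linearP T') /=.
  rewrite scalerBr opprD.
  exact: addrACA.
have := opnorm_ub hX he hl (u := e i); rewrite (basis_norm hX he).
by apply.
Qed.

Lemma sum_sqr_entries_le (R : realType) (p r : nat) (Q : 'M[R]_(r, p)) (b : R) :
  0 <= b -> (forall i j, `|Q i j| <= b) -> mx_dot Q Q <= ((r * p)%:R * b) ^+ 2.
Proof.
move=> b0 hb; rewrite mx_dotE.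
have h : \sum_i \sum_j Q i j * Q i j <= \sum_(i < r) \sum_(j < p) b ^+ 2.
  apply: ler_sum => i _; apply: ler_sum => j _.
  rewrite -expr2 -[X in X <= _]real_normK ?num_real //.
  by rewrite ler_sqr ?nnegrE.
apply: le_trans h _; rewrite !sumr_const !card_ord -mulrnA mulnC.
rewrite -[_ *+ _]mulr_natl exprMn.
apply: ler_wpM2r; first exact: sqr_ge0.
by rewrite -natrX ler_nat; case: (r * p)%N => // m; rewrite -mulnn leq_pmulr.
Qed.

(** Comparing [vb] with [s *: u + vb] and dividing by [s] leaves the quadratic term in [u] with a
    factor [s]. As [s] tends to 0, [l] is seen to lie below the increments of [theta], and
    [subspace_multiplier] applies. *)
Lemma convex_composite_stationary (R : realType) (X Z : normedModType R)
    (ip : {dot X for idfun}) (ipZ : {dot Z for idfun}) (r : nat) (d : 'I_r -> Z)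
    (theta : Z -> R) (T : set X) (A : {linear X -> Z}) (g : X) (Q : {linear X -> X})
    (z0 : Z) (vb : X) :
  orthonormal_basis ipZ d -> convex_function [set: Z] theta ->
  T 0 -> (forall a u v, T u -> T v -> T (a *: u + v)) -> T vb ->
  (forall u w, ip (Q u) w = ip u (Q w)) ->
  (forall u, T u -> ip g vb + 2^-1 * ip vb (Q vb) + theta (z0 + A vb) <=
     ip g u + 2^-1 * ip u (Q u) + theta (z0 + A u)) ->
  exists y, subgradient ipZ theta (z0 + A vb) y /\
    forall u, T u -> ip g u + ip (Q vb) u + ipZ y (A u) = 0.
Proof.
move=> hd ctheta T0 Tlin Tvb Qsym hmin.
pose l u := - (ip g u + ip (Q vb) u).
have hl : scalar l by move=> a u v; rewrite /l !ipDr !ipZr; ring.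
have dom u : T u -> theta (z0 + A vb) + l u <= theta (z0 + A vb + A u).
  move=> Tu; set a := theta (z0 + A vb + A u) - theta (z0 + A vb) - l u.
  have key s : 0 < s -> s <= 1 -> 0 <= a + s * (2^-1 * ip u (Q u)).
    move=> s0 s1; have Tsu : T (s *: u + vb) by exact: Tlin.
    have := hmin _ Tsu.
    have -> : z0 + A (s *: u + vb) =
        s *: (z0 + A vb + A u) + (1 - s) *: (z0 + A vb).
      rewrite linearD linearZ /= [s *: (_ + A u)]scalerDr addrAC -scalerDl.
      by rewrite subrKC scale1r -addrA [A vb + _]addrC.
    have := convex_comb_le ctheta (z0 + A vb + A u) (z0 + A vb) (ltW s0) s1.
    rewrite (linearP Q) /= !(ipDl, ipDr, ipZl, ipZr) -(Qsym vb u) (ipC ip u (Q vb)).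
    move=> h1 h2.
    rewrite -(pmulr_rge0 _ s0) /a /l; nra.
  rewrite -subr_ge0; have -> : theta (z0 + A vb + A u) - (theta (z0 + A vb) + l u) = a.
    by rewrite /a; ring.
  rewrite leNgt; apply/negP => a0; set b := 2^-1 * ip u (Q u) in key.
  have b0 : 0 < b by have := key 1 ltr01 (lexx _); lra.
  (* For this [s] the sum [a + s * b] is at most [a / 2], which is negative. *)
  have m0 : 0 < Num.min 1 (- a / (2 * b)).
    by rewrite lt_min ltr01 /=; apply: divr_gt0; [rewrite oppr_gt0|apply: mulr_gt0].
  have m1 : Num.min 1 (- a / (2 * b)) <= 1 by rewrite ge_min lexx.
  have := key _ m0 m1.
  have : Num.min 1 (- a / (2 * b)) * b <= (- a / (2 * b)) * b.
    by apply: ler_wpM2r; [exact: ltW|rewrite ge_min lexx orbT].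
  have -> : - a / (2 * b) * b = - a / 2 by field; rewrite gt_eqF.
  lra.
have [y [hy yT]] := subspace_multiplier hd ctheta T0 Tlin (linearP A) hl dom.
by exists y; split => // u /yT ->; rewrite /l; ring.
Qed.

(** Positivity tested at [u - a^-1 *: Q u], with the upper bound at [Q u], shows that the squared
    norm of [Q u] is at most [a * ip u (Q u)]. *)
Lemma psd_norm_le (R : realType) (X : normedModType R) (ip : {dot X for idfun})
    (Q : {linear X -> X}) (a : R) : induced_norm ip -> 0 < a ->
  (forall u w, ip (Q u) w = ip u (Q w)) ->
  (forall u, 0 <= ip u (Q u) <= a * `|u| ^+ 2) ->
  forall u, `|Q u| <= a * `|u|.
Proof.
move=> hX a0 Qsym Qb u.
have h1 : `|Q u| ^+ 2 <= a * ip u (Q u).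
  have /andP[+ _] := Qb (u - a^-1 *: Q u).
  have /andP[_ hQ] := Qb (Q u).
  have -> : Q (u - a^-1 *: Q u) = Q u - a^-1 *: Q (Q u).
    by rewrite -scaleNr addrC (linearP Q) scaleNr addrC.
  rewrite !(ipDl, ipDr, ipNl, ipNr, ipZl, ipZr) -(Qsym u (Q u)).
  rewrite (ip_sqr hX) => h.
  have : a^-1 * (a^-1 * ip (Q u) (Q (Q u))) <= a^-1 * `|Q u| ^+ 2.
    by apply: ler_wpM2l; [rewrite invr_ge0 ltW|rewrite ler_pdivrMl].
  move=> h2; rewrite -ler_pdivrMl //; lra.
have /andP[_ h2] := Qb u.
have h3 : `|Q u| ^+ 2 <= (a * `|u|) ^+ 2.
  by apply: le_trans h1 _; rewrite exprMn expr2 -mulrA ler_wpM2l // ltW.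
by move: h3; rewrite ler_sqr // nnegrE // mulr_ge0 // ltW.
Qed.

Lemma nonincreasing_cluster (R : realType) (T : nat -> R) (l : R) :
  (forall k, T k.+1 <= T k) ->
  (forall eps N, 0 < eps -> exists2 k, (N <= k)%N & `|T k - l| < eps) ->
  (forall k, l <= T k) /\ T @ \oo --> l.
Proof.
move=> Tdec Tcl.
have mono m n : (m <= n)%N -> T n <= T m.
  by apply: (homo_leq (r := fun a b => b <= a)) => // y x z xy yz; exact: le_trans yz xy.
have lb k : l <= T k.
  rewrite leNgt; apply/negP => lt.
  have [j kj] := Tcl (l - T k) k (etrans (subr_gt0 _ _) lt).
  by have := mono _ _ kj; rewrite ltr_norml => ? /andP[? ?]; lra.
split=> //; apply/cvgrPdist_lt => eps e0.
have [N _ hN] := Tcl eps 0%N e0; exists N => // k /= Nk.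
have := mono _ _ Nk; have := lb k; move: hN; rewrite !ltr_norml => /andP[? ?] ? ?.
by apply/andP; split; lra.
Qed.

Lemma bounded_nneseries_lt_pinfty (R : realType) (s : nat -> R) (m : nat) (B : R) :
  (forall k, 0 <= s k) -> (forall n, \sum_(m <= k < n) s k <= B) ->
  (\sum_(m <= k <oo) (s k)%:E < +oo)%E.
Proof.
move=> s0 sB; apply: (@le_lt_trans _ _ B%:E); last exact: ltry.
apply: lime_le; first by apply: is_cvg_nneseries => n _ _; rewrite lee_fin.
by apply: nearW => n; rewrite sumEFin lee_fin.
Qed.

(** * Convergence of the run *)

Lemma lip_ge0 (R : realType) (X : normedModType R) (V : zmodType) (nV : V -> R)
    (g : X -> V) (x : X) : (forall y z, 0 <= nV (g y - g z)) -> (0 <= lip nV g x)%E.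
Proof.
move=> h; apply: limf_esup_ge0 => //= yz.
by rewrite lee_fin divr_ge0.
Qed.

Lemma ereal_sup_range_ge0 (R : realType) (I : Type) (i0 : I) (s : I -> \bar R) :
  (forall i, (0 <= s i)%E) -> 0 <= fine (ereal_sup (range s)).
Proof.
move=> h; apply: fine_ge0; apply: le_trans (h i0) _.
by apply: ereal_sup_ubound; exists i0.
Qed.

Section Run.
Variables (R : realType) (X Z : normedModType R).
Variables (ip : {dot X for idfun}) (ipZ : {dot Z for idfun}).
Variables (p r : nat) (e : 'I_p -> X) (d : 'I_r -> Z).
Hypotheses (hX : induced_norm ip) (hZ : induced_norm ipZ).
Hypotheses (he : orthonormal_basis ip e) (hd : orthonormal_basis ipZ d).
Variables (M O : set X).
Hypothesis hM : C2_submanifold ip e M.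
Variables (f : X -> \bar R) (theta : Z -> R) (F : X -> Z).
Hypothesis hprob : standing_assumptions ip M O f theta F.
Variables (Rt : X -> X -> X) (P : RiVMPL_parameters R).
Variables (x : nat -> X) (alpha : nat -> nat -> R) (mu : nat -> R).
Variables (Q : nat -> nat -> {linear X -> X}) (vbar v : nat -> nat -> X).
Variables (LB : nat -> nat -> R) (jk : nat -> nat).
Hypothesis hrun : RiVMPL_run ip M f theta F Rt P x alpha mu Q vbar v LB jk.
Variables (Lam0 Gamma : set X) (D : set Z) (K : RiVMPL_constants R).
Hypothesis hK : valid_constants ip M O f theta F Rt x alpha
  (fun k => v k (jk k)) jk Lam0 Gamma D K.

Let vk k := v k (jk k).
Let bk k := vbar k (jk k).
Let Qk k := Q k (jk k).
Let grad := gradient ip (fine \o f).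
Let aS := b_alpha K + alpha_bar P.
Let cT := c_tilde ip f theta F P K x.
Let Th z := fine (f z) + theta (F z).
Let Cv := 1 + Num.sqrt (2 * mu_max P / alpha_min P).

Lemma run_in_manifold k : M (x k).
Proof. by have [_ LM xL] := vc_Lam0 hK; apply: LM; apply: xL; exists k. Qed.

Lemma fin_on_manifold z : M z -> f z \is a fin_num.
Proof. by move=> /(sa_sub hprob) /(sa_f_fin hprob). Qed.

Lemma objectiveE z : M z -> objective f theta F z = (Th z)%:E.
Proof. by move=> /fin_on_manifold fz; rewrite /objective -(fineK fz) -EFinD. Qed.

Lemma tangent_subspace z : M z -> tangent M z 0 /\
  forall a u w, tangent M z u -> tangent M z w -> tangent M z (a *: u + w).
Proof.
move=> Mz; have [n /(_ z Mz)] := hM.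
move=> [U [V [psi [chi [[oU Uz oV] [[pC cC im psiK] MU]]]]]].
exact: (tangent_linear hX oU oV pC cC im psiK MU Uz Mz).
Qed.

Lemma alpha_star_gt0 : 0 < aS.
Proof. by rewrite addr_gt0 //; [exact: vc_b_alpha hK|exact: alpha_bar_gt0]. Qed.

Lemma Cv_ge0 : 0 <= Cv.
Proof. by rewrite addr_ge0 // sqrtr_ge0. Qed.

Lemma alpha_lower k j : (j <= jk k)%N -> alpha_min P <= alpha k j.
Proof.
elim: j => [_|j IH hj]; first by have /andP[] := run_alpha0 hrun k.
have [_ ->] := run_continue hrun hj.
have := IH (ltnW hj); have := alpha_min_gt0 P; have := sigma_gt1 P; nra.
Qed.

Lemma Q_bounds k u :
  alpha_min P * `|u| ^+ 2 <= ip u (Qk k u) <= aS * `|u| ^+ 2.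
Proof.
have /andP[h1 h2] := run_Q_bounds hrun (leqnn (jk k)) u.
have a1 := alpha_lower (leqnn (jk k)); have a2 := vc_alpha_le hK (leqnn (jk k)).
have n2 : 0 <= `|u| ^+ 2 by exact: sqr_ge0.
apply/andP; split; [apply: le_trans h1|apply: le_trans h2 _].
  exact: ler_wpM2r.
by apply: ler_wpM2r => //; rewrite /aS; lra.
Qed.

Lemma Q_psd k u : 0 <= ip u (Qk k u) <= aS * `|u| ^+ 2.
Proof.
have /andP[h ->] := Q_bounds k u; rewrite andbT; apply: le_trans h.
by rewrite mulr_ge0 ?sqr_ge0 // ltW // alpha_min_gt0.
Qed.

Lemma Q_norm_le k u : `|Qk k u| <= aS * `|u|.
Proof.
apply: (psd_norm_le hX alpha_star_gt0); last exact: Q_psd.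
exact: (run_Q_selfadjoint hrun (leqnn (jk k))).
Qed.

Lemma modelE z (B : X -> X) w : model ip f theta F z B w =
  ip (grad z) w + 2^-1 * ip w (B w) + theta (F z + 'd F z w) + fine (f z).
Proof. by rewrite /model /linearization [z + w - z]addrAC subrr add0r. Qed.

Lemma model0 k : model ip f theta F (x k) (Qk k) 0 = Th (x k).
Proof.
by rewrite modelE (linear0 ('d F (x k))) (linear0 (Qk k)) !ip0r mulr0 !addr0 add0r addrC.
Qed.

(* Strong convexity of the model, tested at the midpoint of the inexact and the
   exact minimizer. *)
Lemma exact_step_le k : `|bk k| <= Cv * `|vk k|.
Proof.
have jj := leqnn (jk k); have ame := alpha_min_gt0 P.
have tv := run_v_tangent hrun jj; have tb := run_vbar_tangent hrun jj.
have [T0 Tlin] := tangent_subspace (run_in_manifold k).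
have Tm : tangent M (x k) ((1 / 2) *: vk k + (1 - 1 / 2) *: bk k).
  apply: (Tlin) => //; have := Tlin (1 - 1 / 2) _ _ tb T0.
  by rewrite addr0.
have := run_vbar_min hrun jj Tm; rewrite -/(bk k) -/(Qk k) !modelE.
have half : 0 <= 1 / 2 :> R /\ 1 / 2 <= 1 :> R by split; lra.
have := convex_comb_le (sa_theta hprob) (F (x k) + 'd F (x k) (vk k))
  (F (x k) + 'd F (x k) (bk k)) half.1 half.2.
have -> : F (x k) + 'd F (x k) ((1 / 2) *: vk k + (1 - 1 / 2) *: bk k) =
  (1 / 2) *: (F (x k) + 'd F (x k) (vk k)) +
  (1 - 1 / 2) *: (F (x k) + 'd F (x k) (bk k)).
  rewrite (linearP ('d F (x k))) /= (linearZ_LR ('d F (x k))) /= !scalerDr.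
  by rewrite addrACA -scalerDl subrKC scale1r.
have := run_v_inexact hrun jj; have := run_LB hrun jj.
rewrite -/(bk k) -/(Qk k) -/(vk k) !modelE.
have /andP[hD _] := Q_bounds k (vk k - bk k).
have := hD; rewrite (raddfB (Qk k)) /= !(ipDl, ipDr, ipNl, ipNr).
rewrite (linearP (Qk k)) /= (linearZ_LR (Qk k)) /= !(ipDl, ipDr, ipZl, ipZr).
have -> : ip (bk k) (Qk k (vk k)) = ip (vk k) (Qk k (bk k)).
  by rewrite ipC (run_Q_selfadjoint hrun jj).
have /andP[_ hmu] := run_mu hrun k.
have mua : mu k / 2 * `|vk k| ^+ 2 <= mu_max P / 2 * `|vk k| ^+ 2.
  by apply: ler_wpM2r; [exact: sqr_ge0|lra].
move=> h1 h2 h3 h4 h5.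
(* The midpoint value lies below the mean of the two model values by one eighth of the squared
   [Q]-norm of the difference and is no less than the value at [bk k]; inexactness bounds the gap of
   the two values by [mu k / 2] times the squared step. This gives the factor 2, and the square root
   in [Cv]. *)
have h6 : alpha_min P * `|vk k - bk k| ^+ 2 <= 2 * mu_max P * `|vk k| ^+ 2 by lra.
have h7 : `|vk k - bk k| <= Num.sqrt (2 * mu_max P / alpha_min P) * `|vk k|.
  rewrite -ler_sqr ?nnegrE ?mulr_ge0 ?sqrtr_ge0 // exprMn sqr_sqrtr; last first.
    by rewrite divr_ge0 ?mulr_ge0 // ltW // mu_max_gt0.
  by rewrite mulrAC ler_pdivlMr // mulrC.
have := ler_normB (vk k) (vk k - bk k); rewrite subKr /Cv mulrDl mul1r; lra.
Qed.

(** The other summands are nonnegative even where a supremum is not finite, because [sup] and [fine]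
    then default to 0. *)
Lemma c_tilde_ge : mu_max P <= cT.
Proof.
rewrite /cT /c_tilde lerDr; apply: addr_ge0; apply: mulr_ge0.
- apply: addr_ge0; last exact: vc_L_grad_f_ge0 hK.
  apply: addr_ge0 => //; apply: mulr_ge0; apply: (ereal_sup_range_ge0 0%N) => k.
    exact: lip_ge0.
  apply: lip_ge0 => y z; apply: (opnorm_ge0 hX he).
  move=> a s t; rewrite -[LHS]/('d F y (a *: s + t) - 'd F z (a *: s + t)).
  rewrite -[RHS]/(a *: ('d F y s - 'd F z s) + ('d F y t - 'd F z t)).
  rewrite (linearP ('d F y)) (linearP ('d F z)) /= scalerBr opprD.
  exact: addrACA.
- exact: sqr_ge0.
- by rewrite mulr_ge0 // ltW //; exact: vc_M2_gt0 hK.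
- apply: addr_ge0; first by apply: sup_nonneg => _ [k _ <-].
  apply: mulr_ge0; last exact: vc_L_theta_ge0 hK.
  by apply: sup_nonneg => _ [k _ <-]; apply: (opnorm_ge0 hX he); exact: linearP.
Qed.

Let Hk k := fine (f (x k)) + (ip (grad (x k)) (bk k)
  + theta (F (x k) + 'd F (x k) (bk k))) + aS / 2 * `|bk k| ^+ 2
  + cT / 2 * `|vk k| ^+ 2.

Lemma descent k : Th (x k.+1) + gamma_bar P / 2 * `|vk k| ^+ 2 <=
  model ip f theta F (x k) (Qk k) (vk k).
Proof.
have := run_exit hrun k => -[|h]; last by case: (run_no_stop hrun h).
rewrite -(run_next hrun) objectiveE; last exact: run_in_manifold.
by rewrite lee_fin -/(Qk k) -/(vk k) lerBrDr.
Qed.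

Lemma objective_decrease k : Th (x k.+1) + gamma_bar P / 2 * `|vk k| ^+ 2 <= Th (x k).
Proof.
apply: le_trans (descent k) _; rewrite -model0.
exact: (run_v_descent hrun (leqnn (jk k))).
Qed.

(** Since [aS] dominates the metric, its term covers the quadratic term of the model at [bk k];
    since [cT] dominates [mu k], its term covers the excess of the model at [vk k] over its
    minimum. *)
Lemma potential_lower k : Th (x k.+1) + gamma_bar P / 2 * `|vk k| ^+ 2 <= Hk k.
Proof.
apply: le_trans (descent k) _.
have := run_v_inexact hrun (leqnn (jk k)); have := run_LB hrun (leqnn (jk k)).
rewrite -/(bk k) -/(Qk k) -/(vk k) (modelE _ _ (bk k)) /Hk.
have /andP[_ hQ] := Q_bounds k (bk k).
have /andP[_ hmu] := run_mu hrun k; have hc := c_tilde_ge.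
have mua : mu k / 2 * `|vk k| ^+ 2 <= cT / 2 * `|vk k| ^+ 2.
  by apply: ler_wpM2r; [exact: sqr_ge0|lra].
lra.
Qed.

(** The exact minimizer does no worse than 0, where the model equals the objective; the remaining
    term in [bk k] is converted by [exact_step_le]. *)
Lemma potential_upper k :
  Hk k <= Th (x k) + (aS * Cv ^+ 2 + cT) / 2 * `|vk k| ^+ 2.
Proof.
have [T0 _] := tangent_subspace (run_in_manifold k).
have := run_vbar_min hrun (leqnn (jk k)) T0.
rewrite -/(bk k) -/(Qk k) model0 modelE /Hk.
have /andP[hQ _] := Q_psd k (bk k).
have hb : `|bk k| ^+ 2 <= Cv ^+ 2 * `|vk k| ^+ 2.
  rewrite -exprMn ler_sqr ?nnegrE ?mulr_ge0 ?Cv_ge0 //; exact: exact_step_le.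
have : aS * `|bk k| ^+ 2 <= aS * (Cv ^+ 2 * `|vk k| ^+ 2).
  by apply: ler_wpM2l => //; apply/ltW/alpha_star_gt0.
lra.
Qed.

(** * The potential along the run and its slope near a cluster point *)

Local Notation E := (X * X * 'M[R]_(r, p) * X * X)%type.
Local Notation dot := (potential_dot ip (p := p) (r := r)).
Local Notation N := (dotnorm dot).
Local Notation Xic := (Xi_c ip e d M f theta F aS cT).

Let uk k : E := (x k, bk k, diff_mx ipZ e d F (x k), grad (x k), vk k).

Lemma potentialE k : Xic (uk k) = (Hk k)%:E.
Proof.
rewrite /Xi_c /Xi /uk /Hk /= /indicator_fun asboolT; last first.
  by split; [exact: run_in_manifold|exact: (run_vbar_tangent hrun (leqnn _))].
rewrite adde0 -(fineK (fin_on_manifold (run_in_manifold k))) -!EFinD.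
by rewrite of_coords_diff_mx.
Qed.

Lemma dF_entry_continuous xb i : O xb -> {for xb, continuous (fun z => 'd F z (e i))}.
Proof.
move=> Oxb; have [L L0 hL] := locally_lipschitz_at (sa_F_lip hprob) Oxb.
apply: (@lipschitz_at_continuous _ _ _ _ _ L); apply: filterS hL => z.
by apply: le_trans; exact: (@opnorm_basis_le _ _ _ ip p e ('d F z) ('d F xb) i hX he).
Qed.

(** Every bound is taken near [xb] in one chart around it, so that [C] does not depend on [k]. *)
Lemma relative_error xb : M xb ->
  exists C rho : R, [/\ 0 < C, 0 < rho & forall k, `|x k - xb| < rho ->
    `|vk k| < rho -> exists G, limiting_subdiff dot Xic (uk k) G /\
      N G <= C * `|vk k|].
Proof.
move=> Mxb; have Oxb := sa_sub hprob Mxb.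
have [n /(_ xb Mxb)] := hM.
move=> [U [V [psi [chi [[oU Uxb oV] [[pC cC im psiK] MU]]]]]].
have nU : \forall z \near xb, U z by exact: open_nbhs_nbhs.
have [Kc Kc0 nKc] : exists2 C : R, 0 <= C &
    \forall z \near xb, forall w, `|'d chi (psi z) w| <= C * `|w|.
  apply: (linear_bounded_near hX he) => [z|i]; first exact: linearP.
  apply: (@continuous_comp _ _ _ psi (fun w => 'd chi w (e i)) xb).
    by apply: differentiable_continuous; exact: pC.1.
  apply: differentiable_continuous; apply: (cC.2 (e i)).1.
  exact: (psiV im Uxb).
have /choice [Kp hKp] j : exists C : R, 0 <= C /\ \forall z \near xb, forall w,
    `|'d (fun z => 'd psi z (e j)) z w| <= C * `|w|.
  have [] := @linear_bounded_near _ _ _ _ ip p e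
    (fun z w => 'd (fun z => 'd psi z (e j)) z w) xb hX he.
  - by move=> z; exact: linearP.
  - by move=> i; exact: ((pC.2 (e j)).2 (e i) xb Uxb).
  - by move=> C C0 hC; exists C.
have nKp : \forall z \near xb, forall j w,
    `|'d (fun z => 'd psi z (e j)) z w| <= (\sum_i Kp i) * `|w|.
  have : \forall z \near xb, forall j, forall w,
      `|'d (fun z => 'd psi z (e j)) z w| <= Kp j * `|w|.
    by apply: filter_forall => j; exact: (hKp j).2.
  apply: filterS => z hz j w; apply: le_trans (hz j w) _.
  apply: ler_wpM2r => //; rewrite (bigD1 j) //= lerDl.
  by apply: sumr_ge0 => i _; exact: (hKp i).1.
have [KF KF0 nKF] : exists2 C : R, 0 <= C &
    \forall z \near xb, forall w, `|'d F z w| <= C * `|w|.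
  apply: (linear_bounded_near hX he) => [z|i]; first exact: linearP.
  exact: dF_entry_continuous.
have [Kg Kg0 nKg] : exists2 C : R, 0 <= C & \forall z \near xb, `|grad z| <= C.
  apply: continuous_bounded_near.
  have [L _ hL] := locally_lipschitz_at (sa_f_lip hprob) Oxb.
  exact: lipschitz_at_continuous hL.
have [Cy hCy] := subgradient_bound hZ hd (sa_theta hprob) (F xb).
have nF : \forall z \near xb, `|F xb - F z| < 1 / 4.
  have /cvgrPdist_lt := differentiable_continuous (sa_F_diff hprob Oxb).
  by apply; lra.
have FF : Filter (nbhs xb) by exact: nbhs_filter.
have /(_ FF FF FF FF FF) nall :=
  filterI nU (filterI nKc (filterI nKp (filterI nKF (filterI nKg nF)))).
have [rho /= rho0 hrho] := (nbhs_normP _ _).1 nall.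
have Cv0 := Cv_ge0; have aS0 := alpha_star_gt0.
have Cy0 : 0 <= `|Cy| by [].
pose Kx := Kg + aS * Cv + `|Cy| * KF.
have Kx0 : 0 <= Kx by rewrite !addr_ge0 ?mulr_ge0 // ltW.
have Kps0 : 0 <= \sum_i Kp i by apply: sumr_ge0 => i _; exact: (hKp i).1.
(* Steps below 1 give [Cv] as a bound on [bk k]. The last entry keeps [KF * Cv] times the step below
   1/4, so that the linearized point is within 1/2 of [F xb], where [Cy] bounds the subgradients. *)
pose rho' := Num.min (Num.min rho 1) (1 / (4 * (KF * Cv + 1))).
have KFv : 0 <= KF * Cv by exact: mulr_ge0.
have den0 : 0 < 4 * (KF * Cv + 1) by lra.
have rho'0 : 0 < rho' by rewrite !lt_min rho0 ltr01 divr_gt0.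
pose C := 2 * aS * Cv +
  (Kx * Kc * ((\sum_i Kp i) * p%:R) + aS + `|Cy| + 1) * Cv + `|cT| + 1.
have B0 : 0 <= Kx * Kc * ((\sum_i Kp i) * p%:R) by rewrite !mulr_ge0.
have C0 : 0 < C.
  have t1 : 0 <= 2 * aS * Cv by apply: mulr_ge0 => //; lra.
  have t2 : 0 <= (Kx * Kc * ((\sum_i Kp i) * p%:R) + aS + `|Cy| + 1) * Cv.
    by apply: mulr_ge0 => //; lra.
  have := normr_ge0 cT; rewrite /C; lra.
exists C, rho'; split=> // k.
rewrite !lt_min => /andP[/andP[hxk _] _] /andP[/andP[_ v1] v2].
have inball : ball_ Num.norm xb rho (x k) by rewrite /ball_ /= distrC.
have [Uk [Kck [Kpk [KFk [Kgk Fk]]]]] := hrho _ inball.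
have Mk := run_in_manifold k; have Ok := sa_sub hprob Mk.
have jj := leqnn (jk k); have tb := run_vbar_tangent hrun jj.
have [T0 Tlin] := tangent_subspace Mk.
have hb := exact_step_le k.
have [y [hy yT]] : exists y, subgradient ipZ theta (F (x k) + 'd F (x k) (bk k)) y /\
    forall u, tangent M (x k) u ->
      ip (grad (x k)) u + ip (Qk k (bk k)) u + ipZ y ('d F (x k) u) = 0.
  apply: (convex_composite_stationary hd (sa_theta hprob) T0 Tlin tb).
    exact: (run_Q_selfadjoint hrun jj).
  move=> u tu; have := run_vbar_min hrun jj tu.
  by rewrite -/(bk k) -/(Qk k) !modelE lerD2r.
have vb1 : `|bk k| <= Cv by apply: le_trans hb _; rewrite ler_piMr // ltW.
have yb : `|y| <= `|Cy|.
  apply: le_trans (ler_norm Cy); apply: hCy hy.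
  rewrite addrAC; apply: le_trans (ler_normD _ _) _; rewrite distrC.
  have := KFk (bk k); move: v2; rewrite ltr_pdivlMr // => v2.
  have : KF * `|bk k| <= KF * (Cv * `|vk k|) by exact: ler_wpM2l.
  have := normr_ge0 (vk k); lra.
have Qb : `|Qk k (bk k)| <= aS * `|bk k| by exact: Q_norm_le.
have xib w : `|- (ip (grad (x k)) w + ip (Qk k (bk k)) w + ipZ y ('d F (x k) w))|
    <= Kx * `|w|.
  rewrite normrN; apply: le_trans (ler_normD _ _) _; rewrite [leRHS]mulrDl.
  apply: lerD.
    apply: le_trans (ler_normD _ _) _; rewrite mulrDl; apply: lerD.
      by apply: le_trans (ip_le hX _ _) _; exact: ler_wpM2r.
    apply: le_trans (ip_le hX _ _) _; apply: ler_wpM2r => //.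
    by apply: le_trans Qb _; apply: ler_wpM2l => //; exact: ltW.
  apply: le_trans (ip_le hZ _ _) _; rewrite -mulrA; exact: ler_pM.
have [|G [hG1 hG2]] := Xi_subgradient (d := d) (ipZ := ipZ) hX hZ he hd
  (fun z => (sa_f_proper hprob).1 z) fin_on_manifold oU oV pC cC im psiK MU
  (q := Qk k (bk k)) (vk k) aS cT Uk Mk tb (sa_f_diff hprob Ok)
  (sa_F_diff hprob Ok) hy _ xib Kck Kpk Kx0 Kc0 Kps0.
  by move=> u tu; rewrite yT ?oppr0.
exists G; split => //; apply: le_trans hG2 _.
rewrite (gtr0_norm aS0) /C.
have q1 : `|Qk k (bk k)| <= aS * (Cv * `|vk k|).
  by apply: le_trans Qb _; apply: ler_wpM2l => //; exact: ltW.
have q2 : (Kx * Kc * ((\sum_i Kp i) * p%:R) + aS + `|y| + 1) * `|bk k| <=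
  (Kx * Kc * ((\sum_i Kp i) * p%:R) + aS + `|Cy| + 1) * (Cv * `|vk k|).
  apply: ler_pM => //; first by have := normr_ge0 y; lra.
  by rewrite lerD2r lerD2l.
have := normr_ge0 (vk k); lra.
Qed.

Let ubar xb : E := (xb, 0, diff_mx ipZ e d F xb, grad xb, 0).

Lemma diff_mx_lipschitz_at xb : O xb -> exists2 L : R, 0 <= L &
  \forall z \near xb, forall i j,
    `|diff_mx ipZ e d F z i j - diff_mx ipZ e d F xb i j| <= L * `|z - xb|.
Proof.
move=> Oxb; have [L L0 hL] := locally_lipschitz_at (sa_F_lip hprob) Oxb.
exists L => //; apply: filterS hL => z; rewrite /= => hz i j; apply: le_trans hz.
rewrite !mxE -ipNr -ipDr; apply: le_trans (coord_le hZ hd _ _) _.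
exact: (@opnorm_basis_le _ _ _ ip p e ('d F z) ('d F xb) j hX he).
Qed.

Lemma grad_lipschitz_at xb : O xb -> exists2 L : R, 0 <= L &
  \forall z \near xb, `|grad z - grad xb| <= L * `|z - xb|.
Proof. exact: locally_lipschitz_at (sa_f_lip hprob). Qed.

Lemma objective_continuous xb : O xb -> {for xb, continuous Th}.
Proof.
move=> Oxb; apply: continuousD.
  exact: (differentiable_continuous (sa_f_diff hprob Oxb)).
apply: continuous_comp; first exact: differentiable_continuous (sa_F_diff hprob Oxb).
exact: (convex_continuous hZ hd (sa_theta hprob)).
Qed.

Lemma potential_at_limit xb : M xb -> Xic (ubar xb) = (Th xb)%:E.
Proof.
move=> Mxb; have [T0 _] := tangent_subspace Mxb.
rewrite /Xi_c /Xi /ubar /= /indicator_fun asboolT // adde0.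
rewrite -(fineK (fin_on_manifold Mxb)) -!EFinD of_coords_diff_mx //.
rewrite (linear0 ('d F xb)) ip0r normr0 expr0n /= !mulr0 !addr0 add0r.
by [].
Qed.

(** Both step components tend to 0 along the full sequence and the others are continuous functions
    of the iterate, so clustering is used for the iterate alone. *)
Lemma cluster_run xb : O xb -> cluster (x @ \oo) xb ->
  (fun k => `|vk k|) @ \oo --> 0 -> cluster (uk @ \oo) (ubar xb).
Proof.
move=> Oxb cl v0.
move=> A B nA [[W4 W5] [/= nW4 nW5] sub4].
have [[W3 Ws] [/= nW3 nWs] sub3] := nW4.
have [[W2 WQ] [/= nW2 nWQ] sub2] := nW3.
have [[Wx Wv] [/= nWx nWv] sub1] := nW2.
have [PQ nPQ subQ] := nWQ.
have bk0 : bk @ \oo --> (0 : X).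
  apply/cvgr0Pnorm_lt => eps e0; have Cv0 := Cv_ge0.
  have e1 : 0 < eps / (Cv + 1) by rewrite divr_gt0 // ltr_pwDr.
  have /cvgr0Pnorm_lt /(_ _ e1) := v0; apply: filterS => k; rewrite normr_id.
  rewrite ltr_pdivlMr ?ltr_pwDr // => hk.
  apply: le_lt_trans (exact_step_le k) _.
  by apply: le_lt_trans hk; rewrite mulrC; apply: ler_wpM2l => //; rewrite lerDl.
have vk0 : vk @ \oo --> (0 : X) by apply/norm_cvg0P.
have cg : {for xb, continuous grad}.
  have [L _ hL] := grad_lipschitz_at Oxb; exact: lipschitz_at_continuous hL.
have cq i j : {for xb, continuous (fun z => diff_mx ipZ e d F z i j)}.
  have [L _ hL] := diff_mx_lipschitz_at Oxb.
  by apply: (@lipschitz_at_continuous _ _ _ _ _ L); apply: filterS hL => z; apply.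
have nq : \forall z \near xb, forall i j, PQ i j (diff_mx ipZ e d F z i j).
  by apply: filter_forall => i; apply: filter_forall => j; apply: cq; exact: nPQ.
(* Clustering of [x] speaks of values and not of indices, so the conditions on [k] are packed into a
   set of values. *)
pose S := [set z | exists k, [/\ z = x k, A (uk k), Wv (bk k) & W5 (vk k)]].
have nS : nbhs (x @ \oo) S.
  have nA' : \forall k \near \oo, A (uk k) := nA.
  have nb : \forall k \near \oo, Wv (bk k) := bk0 _ nWv.
  have nv : \forall k \near \oo, W5 (vk k) := vk0 _ nW5.
  have : \forall k \near \oo, S (x k).
    by apply: filterS3 nA' nb nv => k h1 h2 h3; exists k.
  by [].
have nT : nbhs xb (Wx `&` ((Ws \o grad) `&`
    [set z | forall i j, PQ i j (diff_mx ipZ e d F z i j)])).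
  by apply: filterI => //; apply: filterI => //; apply: cg.
have [z [[k [-> Ak bkW vkW]] [Wxk [Wsk PQk]]]] := cl _ _ nS nT.
exists (uk k); split => //.
apply: (sub4 (uk k)); split => //; apply: (sub3 (uk k).1); split => //.
apply: (sub2 (uk k).1.1); split; last by apply: subQ.
by apply: (sub1 (uk k).1.1.1).
Qed.

(** Trapping controls the iterate and the step, whereas the KL inequality holds on a ball of the
    product norm; the Lipschitz estimates at [xb] connect the two. *)
Lemma potential_dist xb : O xb -> forall delta : R, 0 < delta ->
  exists2 rho : R, 0 < rho & forall k, `|x k - xb| < rho -> `|vk k| < rho ->
    N (uk k - ubar xb) <= delta.
Proof.
move=> Oxb delta delta0.
have [L1 L10 /nbhs_normP [r1 /= r10 h1]] := diff_mx_lipschitz_at Oxb.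
have [L2 L20 /nbhs_normP [r2 /= r20 h2]] := grad_lipschitz_at Oxb.
have Cv0 : 0 <= Cv := Cv_ge0.
pose B := 1 + Cv + (r * p)%:R * L1 + L2 + 1.
have rpL : 0 <= (r * p)%:R * L1 by rewrite mulr_ge0.
have B0 : 0 < B by rewrite /B; lra.
exists (Num.min (Num.min r1 r2) (delta / B)); first by rewrite !lt_min r10 r20 divr_gt0.
move=> k; rewrite !lt_min => /andP[/andP[x1 x2] x3] /andP[_ v3].
have -> : uk k - ubar xb = (x k - xb, bk k - 0,
  diff_mx ipZ e d F (x k) - diff_mx ipZ e d F xb, grad (x k) - grad xb, vk k - 0) by [].
have bound0 : 0 <= (r * p)%:R * (L1 * `|x k - xb|) by rewrite !mulr_ge0.
apply: le_trans (potential_norm_le hX _ _ _ _ bound0 _) _.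
  apply: sum_sqr_entries_le => [|i j]; first exact: mulr_ge0.
  rewrite [X in `|X|](_ : _ =
    diff_mx ipZ e d F (x k) i j - diff_mx ipZ e d F xb i j); last by rewrite !mxE.
  by apply: h1; rewrite /ball_ /= distrC.
have g2 : `|grad (x k) - grad xb| <= L2 * `|x k - xb|.
  by apply: h2; rewrite /ball_ /= distrC.
have hb := exact_step_le k.
rewrite !subr0.
have dB : delta = delta / B * B by rewrite divfK // gt_eqF.
rewrite dB {2}/B.
have m1 : Cv * `|vk k| <= Cv * (delta / B) by apply: ler_wpM2l => //; exact: ltW.
have m2 : (r * p)%:R * (L1 * `|x k - xb|) <= (r * p)%:R * L1 * (delta / B).
  by rewrite mulrA; apply: ler_wpM2l => //; exact: ltW.
have m3 : L2 * `|x k - xb| <= L2 * (delta / B) by apply: ler_wpM2l => //; exact: ltW.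
lra.
Qed.

Lemma run_converges :
  (forall w, cluster (uk @ \oo) w -> KL_property dot Xic w) ->
  (\sum_(1 <= k <oo) `|x k.+1 - x k|%:E < +oo)%E /\
  exists xstar : X, cluster (x @ \oo) xstar /\ x @ \oo --> xstar.
Proof.
move=> hKL; have [cLam LamM xLam] := vc_Lam0 hK.
have xLam' : (x @ \oo) Lam0.
  by have : \forall k \near \oo, Lam0 (x k) by apply: nearW => k; apply: xLam; exists k.
have [xb [Lxb clx]] := cLam _ _ xLam'.
have Mxb := LamM _ Lxb; have Oxb := sa_sub hprob Mxb.
have gam0 := gamma_bar_gt0 P.
have gam20 : 0 < gamma_bar P / 2 by lra.
have dec k : Th (x k.+1) + gamma_bar P / 2 * `|vk k| ^+ 2 <= Th (x k).
  exact: objective_decrease.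
have a2 k : 0 <= gamma_bar P / 2 * `|vk k| ^+ 2.
  by apply: mulr_ge0; [lra|exact: sqr_ge0].
have Tdec k : Th (x k.+1) <= Th (x k) by have := dec k; have := a2 k; lra.
have [Tlb Tcvg] : (forall k, Th xb <= Th (x k)) /\ (fun k => Th (x k)) @ \oo --> Th xb.
  apply: nonincreasing_cluster => // eps n eps0.
  have nS : nbhs (x @ \oo) [set z | exists2 k, (n <= k)%N & z = x k].
    by exists n => // k /= nk; exists k.
  have /cvgrPdist_lt /(_ _ eps0) nT := objective_continuous Oxb.
  have [z [[k nk ->] /= hk]] := clx _ _ nS nT.
  by exists k; rewrite // distrC.
pose t k := Th (x k) - Th xb.
have t0 k : 0 <= t k by rewrite subr_ge0.
have tcvg : t @ \oo --> 0.
  rewrite -[0](subrr (Th xb)); apply: cvgB => //; exact: cvg_cst.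
have at2 k : gamma_bar P / 2 * `|vk k| ^+ 2 <= t k - t k.+1.
  by have := dec k; rewrite /t; lra.
have acvg : (fun k => `|vk k|) @ \oo --> 0.
  apply/cvgr0Pnorm_lt => eps eps0.
  have e1 : 0 < gamma_bar P / 2 * eps ^+ 2 by rewrite mulr_gt0 ?exprn_gt0 //; lra.
  have /cvgr0Pnorm_lt /(_ _ e1) := tcvg; apply: filterS => k.
  rewrite normr_id ger0_norm // => hk.
  have eps0' := ltW eps0; rewrite -ltr_sqr ?nnegrE //.
  rewrite -(ltr_pM2l gam20).
  by apply: le_lt_trans hk; have := at2 k; have := t0 k.+1; lra.
have apos k : 0 < `|vk k|.
  by rewrite lt_neqAle normr_ge0 andbT eq_sym; apply/eqP/(run_no_stop hrun).
have tpos k : 0 < t k.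
  have := at2 k; have := t0 k.+1.
  have : 0 < gamma_bar P / 2 * `|vk k| ^+ 2 by rewrite mulr_gt0 ?exprn_gt0 //; lra.
  lra.
have [_ [delta [varpi [phi [delta0 varpi0 Ups kl]]]]] := hKL _ (cluster_run Oxb clx acvg).
have [C [rho1 [C0 rho10 rel]]] := relative_error Mxb.
have [rho2 rho20 dist] := potential_dist Oxb delta0.
pose rho := Num.min rho1 rho2.
have rho0 : 0 < rho by rewrite lt_min rho10.
pose h k := Hk k - Th xb.
have hlow k : t k.+1 + gamma_bar P / 2 * `|vk k| ^+ 2 <= h k.
  have hk : Th (x k.+1) + gamma_bar P / 2 * `|vk k| ^+ 2 <= Hk k.
    exact: potential_lower.
  by rewrite /h /t; lra.
have hup k : h k <= t k + (aS * Cv ^+ 2 + cT) / 2 * `|vk k| ^+ 2.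
  have hk : Hk k <= Th (x k) + (aS * Cv ^+ 2 + cT) / 2 * `|vk k| ^+ 2.
    exact: potential_upper.
  by rewrite /h /t; lra.
have hpos k : 0 < h k by have := hlow k; have := tpos k.+1; have := a2 k; lra.
have hvarpi : \forall k \near \oo, ((h k)%:E < varpi)%E.
  have bcvg : (fun k => t k + (aS * Cv ^+ 2 + cT) / 2 * `|vk k| ^+ 2) @ \oo --> (0 : R).
    rewrite -[0](_ : 0 + (aS * Cv ^+ 2 + cT) / 2 * 0 ^+ 2 = 0 :> R); last first.
      by rewrite expr0n /= mulr0 addr0.
    by apply: cvgD => //; apply: cvgMr; exact: (cvgM acvg acvg).
  have nb : \forall k \near \oo,
      ((t k + (aS * Cv ^+ 2 + cT) / 2 * `|vk k| ^+ 2)%:E < varpi)%E.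
    exact: bcvg _ (near0_lt_ereal varpi0).
  by apply: filterS nb => k; apply: le_lt_trans; rewrite lee_fin.
(* The bound 1 on the step is the range of validity of [M1]; [rho] serves the slope estimate and the
   KL ball. *)
have [K1 _ hK1] : \forall k \near \oo, ((h k)%:E < varpi)%E /\ `|vk k| < Num.min 1 rho.
  apply: filterI => //; have m0 : 0 < Num.min 1 rho by rewrite lt_min ltr01.
  by have /cvgr0Pnorm_lt /(_ _ m0) := acvg; apply: filterS => k; rewrite normr_id.
have phipos k : (K1 <= k)%N -> 0 <= phi (t k.+1).
  move=> Kk; case: Ups => _ _ + _ _; apply; split; first exact: t0.
  have [+ _] := hK1 _ Kk; apply: le_lt_trans; rewrite lee_fin.
  by have := hlow k; have := a2 k; lra.
have M10 := vc_M1_gt0 hK.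
have C'0 : 0 <= C / gamma_bar P by rewrite divr_ge0 // ltW.
(* The absolute value makes the sequence nonnegative at every index: the sign of [phi] is known only
   below [varpi], which early values of [t] may exceed. *)
have [|k /hK1 [_]|k Kk hk|xcvg [B hB]] := @trapping R X x xb (fun k => `|vk k|)
   (fun k => `|phi (t k)|) (M1 K) (C / gamma_bar P) rho K1 (ltW M10) C'0 rho0
   (fun=> normr_ge0 _) (fun=> normr_ge0 _) acvg _ _ _ clx.
- rewrite -[0](normr0 R); apply: cvg_norm.
  exact: (Upsilon_cvg0 Ups varpi0 t0 tcvg).
- rewrite lt_min => /andP[v1 _]; rewrite (run_next hrun).
  apply: (vc_M1 hK); [by apply: xLam; exists k| |exact: ltW].
  exact: (run_v_tangent hrun (leqnn _)).
- have [hv] := hK1 _ Kk; rewrite !lt_min => /andP[_ /andP[v1 v2]].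
  move: (hk); rewrite lt_min => /andP[k1 k2].
  have [G [hG1 hG2]] := rel _ k1 v1.
  have XE : Xic (uk k) = (Hk k)%:E by exact: potentialE.
  have := kl (uk k) (dist _ k2 v2); rewrite XE potential_at_limit // lte_fin.
  have hkp := hpos k; rewrite {1}/h subr_gt0 in hkp.
  move=> /(_ hkp); rewrite -lteBlDl // -EFinB => /(_ hv) /= hd1.
  have [_ _ dphi] : [/\ derivable phi (h k) 1, {for h k, continuous (derive1 phi)} &
      0 < derive1 phi (h k)] by case: Ups => _ _ _ _; apply.
  have key : 1 <= derive1 phi (h k) * (C * `|vk k|).
    rewrite -lee_fin; apply: le_trans hd1 _; rewrite EFinM.
    apply: lee_wpmul2l; first by rewrite lee_fin ltW.
    by apply: le_trans (dist0_le _ hG1) _; rewrite lee_fin.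
  have th : t k.+1 <= h k by have := hlow k; have := a2 k; lra.
  have t2t1 : t k.+2 <= t k.+1 by have := at2 k.+1; have := a2 k.+1; lra.
  have := Upsilon_descent Ups (tpos k.+1) th hv (t0 k.+2) t2t1.
  rewrite !ger0_norm ?phipos // ?(leq_trans Kk) //.
  set s1 := phi _; set s2 := phi _ => hs.
  (* The slope bound [key] is multiplied by the lower bound [at2] for [t k.+1 - t k.+2]; [hs] then
     replaces the derivative by [s1 - s2]. *)
  have step : gamma_bar P / 2 * `|vk k.+1| ^+ 2 <= (s1 - s2) * (C * `|vk k|).
    have q1 : derive1 phi (h k) * (gamma_bar P / 2 * `|vk k.+1| ^+ 2) <= s1 - s2.
      apply: le_trans hs; apply: ler_wpM2l; [exact: ltW|exact: at2].
    have Cv1 : 0 <= C * `|vk k| by rewrite mulr_ge0 // ltW.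
    apply: le_trans (ler_wpM2r Cv1 q1).
    have := ler_wpM2r (a2 k.+1) key; rewrite mul1r; lra.
  have s12 : 0 <= s1 - s2.
    apply: le_trans hs; apply: mulr_ge0; first exact: ltW.
    by rewrite subr_ge0.
  rewrite -ler_sqr ?nnegrE; last 2 first.
    exact: normr_ge0.
    by apply: addr_ge0; [rewrite divr_ge0|apply: mulr_ge0].
  (* With [a] the step at [k] and [g] equal to [C / gamma_bar P * (s1 - s2)], the recursion follows
     from [2 * g * a <= (a / 2 + g) ^+ 2]. *)
  have AMGM : `|vk k.+1| ^+ 2 <= 2 * (C / gamma_bar P) * (s1 - s2) * `|vk k|.
    rewrite -(ler_pM2l gam20).
    apply: le_trans step _; rewrite le_eqVlt; apply/orP; left; apply/eqP.
    by field; rewrite gt_eqF.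
  apply: le_trans AMGM _; set g := C / _ * _.
  have -> : 2 * (C / gamma_bar P) * (s1 - s2) * `|vk k| = 2 * g * `|vk k|.
    by rewrite /g; ring.
  by have := sqr_ge0 (`|vk k| / 2 - g); lra.
split; last by exists xb.
exact: (bounded_nneseries_lt_pinfty (fun=> normr_ge0 _) hB).
Qed.

End Run.

Theorem theorem5p2 (R : realType) (X Z : normedModType R)
  (ip : {dot X for idfun}) (ipZ : {dot Z for idfun})
  (p r : nat) (e : 'I_p -> X) (d : 'I_r -> Z)
  (hX : induced_norm ip) (hZ : induced_norm ipZ)
  (he : orthonormal_basis ip e) (hd : orthonormal_basis ipZ d)
  (M O : set X) (hM : C2_submanifold ip e M) (hMc : closed M)
  (f : X -> \bar R) (theta : Z -> R) (F : X -> Z)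
  (hprob : standing_assumptions ip M O f theta F)
  (Rt : X -> X -> X) (hRt : retraction M Rt)
  (P : RiVMPL_parameters R)
  (x : nat -> X) (alpha : nat -> nat -> R) (mu : nat -> R)
  (Q : nat -> nat -> {linear X -> X}) (vbar v : nat -> nat -> X)
  (LB : nat -> nat -> R) (jk : nat -> nat)
  (hrun : RiVMPL_run ip M f theta F Rt P x alpha mu Q vbar v LB jk)
  (hbounded : bounded_set (range x))
  (Lam0 Gamma : set X) (D : set Z) (K : RiVMPL_constants R)
  (hK : valid_constants ip M O f theta F Rt x alpha (fun k => v k (jk k)) jk
          Lam0 Gamma D K)
  (u : nat -> X * X * 'M[R]_(r, p) * X * X)
  (hu : forall k, u k = (x k, vbar k (jk k), diff_mx ipZ e d F (x k),
                         gradient ip (fine \o f) (x k), v k (jk k)))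
  (hKL : forall ubar, cluster (u @ \oo) ubar ->
     KL_property (potential_dot ip (p := p) (r := r))
       (Xi_c ip e d M f theta F (b_alpha K + alpha_bar P)
          (c_tilde ip f theta F P K x)) ubar) :
  (\sum_(1 <= k <oo) `|x k.+1 - x k|%:E < +oo)%E /\
  exists xstar : X, cluster (x @ \oo) xstar /\ x @ \oo --> xstar.
Proof.
apply: (run_converges hX hZ he hd hM hprob hrun hK).
by have uE := funext hu; subst u; exact: hKL.
Qed.
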